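(* Let $\lambda,\mu$ be partitions of $N$. Then $r_\mu-r_\lambda$ is Schur positive if and only if $\mu\le_{dom}\lambda$ and $\ell(\lambda)=\ell(\mu)$.
   Context: For a composition $\alpha=(\alpha_1,\dots,\alpha_L)$ (positive integers; a partition is regarded as a composition), the ribbon Schur function $r_\alpha$ is the skew Schur function $s_{\lambda/\mu}$ of the ribbon (connected skew diagram containing no $2\times2$ square) whose rows, from top to bottom, have $\alpha_1,\dots,\alpha_L$ boxes, consecutive rows sharing exactly one column; i.e. $\lambda_i-\mu_i=\alpha_i$ and $\lambda_{i+1}-\mu_i=1$. Here $s_{\lambda/\mu}$ is the generating function $\sum_T x^{c(T)}$ of semistandard Young tableaux of shape $\lambda/\mu$. $\ell(\lambda)$ is the number of parts. Dominance order: $\mu\le_{dom}\lambda$ iff $\mu_1+\dots+\mu_i\le\lambda_1+\dots+\lambda_i$ for all $i$ (missing parts taken as $0$). A symmetric function is Schur positive if it is a non-negative linear combination of Schur functions. *)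

(* Defs.v *)
From HB Require Import structures.
From mathcomp Require Import all_boot all_order all_algebra.
Unset Printing Implicit Defensive.
Import GRing.Theory Num.Theory.

Definition is_partition (l : seq nat) : bool :=
  sorted geq l && all (fun x => 0 < x) l.

Definition is_composition (l : seq nat) : bool := all (fun x => 0 < x) l.

Definition in_skew (lam mu : seq nat) (i j : nat) : bool :=
  (nth 0 mu i <= j) && (j < nth 0 lam i).

(* all cells of lam/mu have row and column index < box_bound lam *)
Definition box_bound (lam : seq nat) : nat := size lam + sumn lam.

(* A filling T of the box by {0,..,n}; value 0 means "no cell".
   T is an SSYT of shape lam/mu with entries in {1..n} iff it is nonzero
   exactly on the cells of lam/mu, rows weakly increase, columns strictly
   increase. *)
Definition is_ssyt (lam mu : seq nat) (n : nat)
  (T : {ffun 'I_(box_bound lam) * 'I_(box_bound lam) -> 'I_n.+1}) : bool :=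
  [forall c : 'I_(box_bound lam) * 'I_(box_bound lam),
      in_skew lam mu c.1 c.2 == (val (T c) != 0)] &&
  [forall i : 'I_(box_bound lam), forall j : 'I_(box_bound lam),
     forall j' : 'I_(box_bound lam),
      [&& in_skew lam mu i j, in_skew lam mu i j' & (j < j')]
        ==> (val (T (i, j)) <= val (T (i, j')))] &&
  [forall i : 'I_(box_bound lam), forall i' : 'I_(box_bound lam),
     forall j : 'I_(box_bound lam),
      [&& in_skew lam mu i j, in_skew lam mu i' j & (i < i')]
        ==> (val (T (i, j)) < val (T (i', j)))].

Definition content (lam : seq nat) (n : nat)
  (T : {ffun 'I_(box_bound lam) * 'I_(box_bound lam) -> 'I_n.+1}) (k : 'I_n) : nat :=
  #|[set c | val (T c) == k.+1]|.

(* Coefficient of the monomial x_1^{a_1} ... x_n^{a_n} in the skew Schur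
   polynomial s_{lam/mu}(x_1,...,x_n) = sum_T x^{c(T)}. *)
Definition skew_coef (lam mu : seq nat) (n : nat) (a : 'I_n -> nat) : nat :=
  #|[set T : {ffun 'I_(box_bound lam) * 'I_(box_bound lam) -> 'I_n.+1} |
      is_ssyt lam mu n T && [forall k : 'I_n, content lam n T k == a k]]|.

Definition schur_coef (nu : seq nat) (n : nat) (a : 'I_n -> nat) : nat :=
  skew_coef nu [::] n a.

(* The ribbon of composition al = (al_1..al_L): lam_i - mu_i = al_i,
   lam_{i+1} - mu_i = 1, mu_L = 0. *)
Definition ribbon_lam (al : seq nat) : seq nat :=
  mkseq (fun i => sumn (drop i al) - (size al - i.+1)) (size al).
Definition ribbon_mu (al : seq nat) : seq nat :=
  mkseq (fun i => nth 0 (ribbon_lam al) i.+1 - 1) (size al).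

Definition ribbon_coef (al : seq nat) (n : nat) (a : 'I_n -> nat) : nat :=
  skew_coef (ribbon_lam al) (ribbon_mu al) n a.

(* A polynomial in n variables (given by its coefficient function) is a
   non-negative linear combination of Schur polynomials. *)
Definition schur_pos_n (n : nat) (f : ('I_n -> nat) -> rat) : Prop :=
  exists (s : seq (seq nat)) (c : seq nat -> rat),
    all is_partition s /\ (forall nu, (0 <= c nu)%R) /\
    forall a, f a = (\sum_(nu <- s) c nu * (schur_coef nu n a)%:R)%R.

(* A symmetric function (given by its restrictions to n variables, for
   every n) is Schur positive. *)
Definition schur_positive (f : forall n, ('I_n -> nat) -> rat) : Prop :=
  forall n, schur_pos_n n (f n).

Definition dom_le (mu lam : seq nat) : Prop :=
  forall i, sumn (take i mu) <= sumn (take i lam).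

(* Main.v *)
(* Stembridge's sign-reversing argument expands a skew Schur function as the sum
   of s_wt(T) over its lattice fillings T, so r_mu - r_lam is Schur positive iff
   for every kappa the ribbon mu has at least as many lattice fillings of weight
   kappa as the ribbon lam. A lattice filling of the ribbon alpha of weight kappa
   is the same as a semistandard tableau of shape kappa and content alpha in
   which, for every i, some letter i+1 lies in a lower row than some letter i.

   Necessity: the diagonal filling of weight lam, where row k contains only the
   letter k, forces mu <= lam, and a filling of hook weight forces
   l(mu) <= l(lam).

   Sufficiency: for lam above mu of the same length there is a partition covered
   by lam that is still above mu, obtained either by moving a box between
   adjacent parts, where the crystal operator f_i is injective and keeps all the
   pairs i, i+1, or by replacing a block (c+1, c, .., c, c-1) by (c, .., c). In
   the second case plain composition of the f_i may lose a pair; the order of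
   application is chosen according to the decreasing chains t+1, t, t-1 present
   in the tableau, and can be read off from the result. *)
Require Import Defs.
From mathcomp Require Import all_boot all_order all_algebra all_fingroup.
From mathcomp Require Import boolp.
From mathcomp Require Import zify.
Set Implicit Arguments.
Unset Strict Implicit.
Unset Printing Implicit Defensive.

(** The operator f_t removes one letter t and adds one letter t+1, so the only pair it can break is
    that of t-1 and t, and only if the lowest t is the one that moves. Two excess letters t over t+1
    exclude this; so does one excess letter if some t+1 has no t in a higher row. Such a t+1 exists
    as soon as the pair t+1, t+2 is present without a chain t, t+1, t+2. This is why the step on a
    block begins at the last chain before the deficit: beyond it there are no chains, and the chain
    itself protects the pair at which the step begins, where no excess letter is available. The same
    chain, which the step preserves, later marks the place where the step has to be undone. *)

Definition mat := nat -> nat -> nat.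

(** * Partial sums and the places where a maximum is attained *)

Definition psum (a : nat -> nat) (i : nat) : nat := \sum_(k < i) a k.

Lemma psum0 a : psum a 0 = 0.
Proof. by rewrite /psum big_ord0. Qed.

Lemma psumS a i : psum a i.+1 = psum a i + a i.
Proof. by rewrite /psum big_ord_recr. Qed.

Lemma leq_psum a i j : i <= j -> psum a i <= psum a j.
Proof.
move/subnKC<-; elim: (j - i) => [|d IH]; first by rewrite addn0.
by rewrite addnS psumS; lia.
Qed.

Lemma eq_psum a b i : (forall k, k < i -> a k = b k) -> psum a i = psum b i.
Proof. by move=> h; apply: eq_bigr => k _; apply: h. Qed.

Lemma psum_eq0 a i : (forall k, k < i -> a k = 0) -> psum a i = 0.
Proof. by move=> h; apply: big1 => k _; apply: h. Qed.

Lemma psum_gt a i j k : i <= k -> k < j -> psum a i + a k <= psum a j.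
Proof.
move=> ik kj; apply: leq_trans (leq_psum a kj); rewrite psumS.
by rewrite leq_add2r leq_psum.
Qed.

Lemma psum_ex a i j : psum a i < psum a j -> exists k, [/\ i <= k, k < j & 0 < a k].
Proof.
elim: j => [|j IH]; first by rewrite psum0.
rewrite psumS; case: (posnP (a j)) => [->|a0].
  by rewrite addn0 => /IH[k [? ? ?]]; exists k; split=> //; lia.
move=> h; exists j; split=> //.
by case: leqP => // ji; have := leq_psum a ji; rewrite psumS; lia.
Qed.

Lemma psum_delta i R : psum (fun r => r == i : nat) R = (i < R).
Proof.
elim: R => [|R IH]; rewrite ?psum0 // psumS IH; lia.
Qed.

Lemma psum_add a b i : psum (fun k => a k + b k) i = psum a i + psum b i.
Proof. by rewrite /psum big_split. Qed.

Lemma psum_stable a R R' : (forall k, R <= k -> a k = 0) -> R <= R' ->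
  psum a R' = psum a R.
Proof.
move=> h /subnKC<-; elim: (R' - R) => [|d IH]; first by rewrite addn0.
by rewrite addnS psumS IH h ?leq_addr ?addn0.
Qed.

(** The range includes R because, for heights, R stands for the position after all rows; a last
    maximum there means that no letter can be raised. *)
Fixpoint last_max (g : nat -> int) (R : nat) : nat :=
  if R is R'.+1 then let i := last_max g R' in if (g i <= g R)%R then R else i
  else 0.

Fixpoint first_max (g : nat -> int) (R : nat) : nat :=
  if R is R'.+1 then let i := first_max g R' in if (g i < g R)%R then R else i
  else 0.

Lemma last_maxP g R (i := last_max g R) :
  [/\ i <= R, (forall r, r <= R -> (g r <= g i)%R) &
      (forall r, i < r -> r <= R -> (g r < g i)%R)].
Proof.
rewrite {}/i; elim: R => [|R [h1 h2 h3]] /=.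
  by split=> // r; [rewrite leqn0 => /eqP-> | lia].
case: ifP => h; split=> //; try lia.
- move=> r; rewrite leq_eqVlt ltnS => /orP[/eqP->//|/h2]; lia.
- move=> r; rewrite leq_eqVlt ltnS => /orP[/eqP->//|/h2]; lia.
- move=> r; rewrite [r <= _]leq_eqVlt ltnS => ? /orP[/eqP->//|/h3]; lia.
Qed.

Lemma first_maxP g R (i := first_max g R) :
  [/\ i <= R, (forall r, r <= R -> (g r <= g i)%R) &
      (forall r, r < i -> (g r < g i)%R)].
Proof.
rewrite {}/i; elim: R => [|R [h1 h2 h3]] /=.
  by split=> // r; rewrite leqn0 => /eqP->.
case: ifP => h; split=> //; try lia.
- move=> r; rewrite leq_eqVlt ltnS => /orP[/eqP->//|/h2]; lia.
- by move=> r; rewrite ltnS => /h2; lia.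
- move=> r; rewrite leq_eqVlt ltnS => /orP[/eqP->//|/h2]; lia.
Qed.

Lemma last_max_uniq g R i : i <= R -> (forall r, r < i -> (g r <= g i)%R) ->
  (forall r, i < r -> r <= R -> (g r < g i)%R) -> last_max g R = i.
Proof.
move=> iR h1 h2; have [k1 k2 k3] := last_maxP g R.
case: (ltngtP (last_max g R) i) => // c.
- by have := k3 _ c iR; have := h1 _ c; lia.
- by have := k2 _ iR; have := h2 _ c k1; lia.
Qed.

Lemma first_max_uniq g R i : i <= R -> (forall r, r < i -> (g r < g i)%R) ->
  (forall r, i < r -> r <= R -> (g r <= g i)%R) -> first_max g R = i.
Proof.
move=> iR h1 h2; have [k1 k2 k3] := first_maxP g R.
case: (ltngtP (first_max g R) i) => // c.
- by have := k2 _ iR; have := h1 _ c; lia.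
- by have := k3 _ c; have := h2 _ c k1; lia.
Qed.

(** * Kashiwara operators on counting matrices *)

Definition col (m : mat) (t : nat) : nat -> nat := fun r => m r t.

Lemma colE m t r : col m t r = m r t. Proof. by []. Qed.

(* The rows are read from the top one down, and each row from right to left, so
   that in row r the letters t+1 come before the letters t. [height m t r] is
   the excess of letters t+1 over letters t just after the letters t+1 of r. *)
Definition height (m : mat) (t r : nat) : int :=
  ((psum (col m t.+1) r.+1)%:Z - (psum (col m t) r)%:Z)%R.

Definition frow R t m := last_max (height m t) R.
Definition erow R t m := first_max (height m t) R.
(** The usual string length epsilon_t: each [eop] lowers it by 1 and each [fop] raises it by 1. *)
Definition eps R t m : int := height m t (frow R t m).

(** The subtraction is truncated, so this is the Kashiwara operator only if row i contains a letter
    t; the recurring hypothesis [0 < m (frow R t m) t] says so. For [eop] the corresponding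
    condition is [0 < eps R t m]. *)
Definition fop R t m : mat := let i := frow R t m in fun r x =>
  m r x + ((r == i) && (x == t.+1)) - ((r == i) && (x == t)).
Definition eop R t m : mat := let i := erow R t m in fun r x =>
  m r x + ((r == i) && (x == t)) - ((r == i) && (x == t.+1)).

Definition rowsupp R (m : mat) := forall r x, R <= r -> m r x = 0.

Section Ops.
Variables (R t : nat) (m : mat).
Hypothesis mR : rowsupp R m.
Let a := col m t.
Let b := col m t.+1.

Lemma psum_colR x r : R <= r -> psum (col m x) r = psum (col m x) R.
Proof. by apply: psum_stable => k kR; apply: mR. Qed.

Lemma height_R r : R <= r -> height m t r = height m t R.
Proof.
by move=> Rr; rewrite /height !psum_colR //; apply: leq_trans Rr _.
Qed.

Lemma frowP (i := frow R t m) : 0 < m i t ->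
  [/\ i < R,
     (forall r, r < i -> psum b r.+1 + psum a i <= psum b i.+1 + psum a r) &
     (forall r, i < r -> psum b r.+1 + psum a i < psum b i.+1 + psum a r)].
Proof.
rewrite {}/i /frow; case: (last_maxP (height m t) R).
set i := last_max _ _ => h1 h2 h3 mi.
have iR : i < R by case: ltnP => // /(mR t) e; rewrite e in mi.
split=> // r ri.
  by have := h2 r ltac:(lia); rewrite /height -/a -/b; lia.
case: (leqP r R) => rR; first by have := h3 r ri rR; rewrite /height -/a -/b; lia.
have := h3 R iR (leqnn R); rewrite -(height_R (ltnW rR)) /height -/a -/b; lia.
Qed.

Lemma erowP (i := erow R t m) : (0 < eps R t m)%R ->
  [/\ i < R, 0 < m i t.+1, height m t i = eps R t m,
     (forall r, r < i -> psum b r.+1 + psum a i < psum b i.+1 + psum a r) &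
     (forall r, i < r -> psum b r.+1 + psum a i <= psum b i.+1 + psum a r)].
Proof.
rewrite /eps {}/i /erow /frow.
case: (last_maxP (height m t) R) => k1 k2 k3.
case: (first_maxP (height m t) R); set i := first_max _ _ => h1 h2 h3 pos.
have e1 : height m t i = height m t (last_max (height m t) R).
  by have := h2 _ k1; have := k2 _ h1; lia.
rewrite -e1 in pos *.
have mi : 0 < m i t.+1.
  case: i h1 h2 h3 e1 pos => [|i] h1 h2 h3 e1; rewrite /height.
    by rewrite psumS !psum0 add0n /col; lia.
  move=> _; have := h3 i (leqnn _); rewrite /height !psumS /col; lia.
have iR : i < R by case: ltnP => // /(mR t.+1) e; rewrite e in mi.
split=> // r ri.
  by have := h3 r ri; rewrite /height -/a -/b; lia.
case: (leqP r R) => rR; first by have := h2 r rR; rewrite /height -/a -/b; lia.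
have := h2 R (leqnn R); rewrite -(height_R (ltnW rR)) /height -/a -/b; lia.
Qed.

Lemma eps_max r : (height m t r <= eps R t m)%R.
Proof.
have [h1 h2 h3] := last_maxP (height m t) R.
case: (leqP r R) => rR; first exact: h2.
by rewrite (height_R (ltnW rR)); apply: h2.
Qed.

Lemma height_psum : height m t R = ((psum b R)%:Z - (psum a R)%:Z)%R.
Proof. by rewrite /height psum_colR ?leqnSn. Qed.

Lemma eps_ge0 : (0 <= eps R t m)%R.
Proof. by have := eps_max 0; rewrite /height psum0; lia. Qed.

(** The hypothesis is phi_t > 0. The height at R is then below the maximum, so the last maximum is
    followed by a drop, which only a letter t in that row can cause. *)
Lemma f_defined : ((psum b R)%:Z < (psum a R)%:Z + eps R t m)%R ->
  0 < m (frow R t m) t.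
Proof.
rewrite /eps /frow; have [h1 h2 h3] := last_maxP (height m t) R.
move: h1 h2 h3; set i := last_max _ _ => h1 h2 h3 h.
move: h1; rewrite leq_eqVlt => /orP[/eqP iR|iR].
  by rewrite iR /height psum_colR ?leqnSn // -/a -/b in h; lia.
have := h3 i.+1 (leqnn _) iR; rewrite /height !psumS /col; lia.
Qed.

End Ops.

Section FOps.
Variables (R t : nat) (m : mat).
Hypotheses (mR : rowsupp R m) (md : 0 < m (frow R t m) t).
Let i := frow R t m.

Lemma fop_supp : rowsupp R (fop R t m).
Proof.
move=> r x rR; have [iR _ _] := frowP mR md; rewrite /fop (mR x rR).
by case: eqP => [e|] //; lia.
Qed.

Lemma fop_row r x : r != i -> fop R t m r x = m r x.
Proof. by rewrite /fop => /negbTE->; rewrite addn0 subn0. Qed.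

Lemma fop_col r x : x != t -> x != t.+1 -> fop R t m r x = m r x.
Proof. by rewrite /fop => /negbTE-> /negbTE->; rewrite !andbF addn0 subn0. Qed.

Lemma fop_t r : fop R t m r t + (r == i) = m r t.
Proof.
rewrite /fop eqxx andbT -/i; case: (eqVneq r i) md => [->|_] /=; rewrite -/i; lia.
Qed.

Lemma fop_t1 r : fop R t m r t.+1 = m r t.+1 + (r == i).
Proof. by rewrite /fop eqxx andbT -/i (gtn_eqF (ltnSn t)) andbF subn0. Qed.

Lemma psum_fop_t j : psum (col (fop R t m) t) j + (i < j) = psum (col m t) j.
Proof.
by rewrite -psum_delta -psum_add; apply: eq_psum => k _; apply: fop_t.
Qed.

Lemma psum_fop_t1 j : psum (col (fop R t m) t.+1) j = psum (col m t.+1) j + (i < j).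
Proof.
by rewrite -psum_delta -psum_add; apply: eq_psum => k _; apply: fop_t1.
Qed.

Lemma psum_fop x j : x != t -> x != t.+1 ->
  psum (col (fop R t m) x) j = psum (col m x) j.
Proof. by move=> ? ?; apply: eq_psum => k _; apply: fop_col. Qed.

Lemma psum_fop_row r x : psum (fop R t m r) x + ((r == i) && (x == t.+1)) = psum (m r) x.
Proof.
case: (eqVneq r i) => /= [->|ri]; last first.
  by rewrite addn0; apply: eq_psum => k _; apply: fop_row.
elim: x => [|x IH]; first by rewrite !psum0.
rewrite !psumS eqSS; move: (fop_t i) (fop_t1 i) (@fop_col i x); rewrite eqxx => h1 h2 h3.
case: (eqVneq x t) IH h3 => [->|xt] IH h3.
  by move: IH; case: eqP; lia.
case: (eqVneq x t.+1) IH h3 => [->|xt1] IH h3; last by rewrite h3 //; lia.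
lia.
Qed.

(** Raising a letter in row i adds 1 to the height at i and 2 to all later heights. The latter were
    smaller by at least 1, so i becomes the first maximum. *)
Lemma erow_fop : erow R t (fop R t m) = i.
Proof.
have [iR h1 h2] := frowP mR md; rewrite -/i in iR h1 h2.
apply: first_max_uniq; first exact: ltnW.
- move=> r ri; rewrite /height !psum_fop_t1.
  move: (psum_fop_t r) (psum_fop_t i) (h1 _ ri).
  by rewrite -/i; case: (ltnP i r.+1) (ltnP i i.+1) (ltnP i r) (ltnP i i) => ? [] ? [] ? [] ? /=; lia.
- move=> r ri _; rewrite /height !psum_fop_t1.
  move: (psum_fop_t r) (psum_fop_t i) (h2 _ ri).
  by rewrite -/i; case: (ltnP i r.+1) (ltnP i i.+1) (ltnP i r) (ltnP i i) => ? [] ? [] ? [] ? /=; lia.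
Qed.

Lemma eps_fop : eps R t (fop R t m) = (eps R t m + 1)%R.
Proof.
have e : height (fop R t m) t i = (eps R t m + 1)%R.
  rewrite /eps /height -/i psum_fop_t1; move: (psum_fop_t i).
  by rewrite ltnn ltnSn; lia.
rewrite -e; have := erow_fop; have [p1 p2 p3] := first_maxP (height (fop R t m) t) R.
rewrite /erow => ei; rewrite ei in p1 p2 p3.
have q : (0 < eps R t (fop R t m))%R.
  have := eps_max t fop_supp i; have := eps_ge0 t mR; lia.
have [_ _ <- _ _] := erowP fop_supp q.
by rewrite -ei.
Qed.

Lemma fopK : eop R t (fop R t m) = m.
Proof.
apply/funext => r; apply/funext => x; rewrite /eop erow_fop /fop -/i.
case: (eqVneq r i) => [->|_] /=; last lia.
by have := md; rewrite -/i; case: (eqVneq x t) => [->|] /=; case: (eqVneq) => /=; lia.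
Qed.

End FOps.

Section EOps.
Variables (R t : nat) (m : mat).
Hypotheses (mR : rowsupp R m) (mp : (0 < eps R t m)%R).
Let i := erow R t m.

Lemma eop_t r : eop R t m r t = m r t + (r == i).
Proof. by rewrite /eop eqxx andbT -/i (ltn_eqF (ltnSn t)) andbF subn0. Qed.

Lemma eop_t1 r : eop R t m r t.+1 + (r == i) = m r t.+1.
Proof.
have [_ h _ _ _] := erowP mR mp; move: h; rewrite /eop eqxx andbT -/i.
by case: (eqVneq r i) => [->|_] /=; lia.
Qed.

Lemma eop_row r x : r != i -> eop R t m r x = m r x.
Proof. by rewrite /eop => /negbTE->; rewrite addn0 subn0. Qed.

Lemma eop_col r x : x != t -> x != t.+1 -> eop R t m r x = m r x.
Proof. by rewrite /eop => /negbTE-> /negbTE->; rewrite !andbF addn0 subn0. Qed.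

Lemma eop_supp : rowsupp R (eop R t m).
Proof.
move=> r x rR; have [iR _ _ _ _] := erowP mR mp; rewrite /eop (mR x rR).
by case: eqP => [e|] //; lia.
Qed.

Lemma psum_eop_t j : psum (col (eop R t m) t) j = psum (col m t) j + (i < j).
Proof.
by rewrite -psum_delta -psum_add; apply: eq_psum => k _; apply: eop_t.
Qed.

Lemma psum_eop_t1 j : psum (col (eop R t m) t.+1) j + (i < j) = psum (col m t.+1) j.
Proof.
by rewrite -psum_delta -psum_add; apply: eq_psum => k _; apply: eop_t1.
Qed.

Lemma psum_eop x j : x != t -> x != t.+1 ->
  psum (col (eop R t m) x) j = psum (col m x) j.
Proof. by move=> ? ?; apply: eq_psum => k _; apply: eop_col. Qed.

Lemma psum_eop_row r x : psum (eop R t m r) x = psum (m r) x + ((r == i) && (x == t.+1)).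
Proof.
case: (eqVneq r i) => /= [->|ri]; last first.
  by rewrite addn0; apply: eq_psum => k _; apply: eop_row.
elim: x => [|x IH]; first by rewrite !psum0.
rewrite !psumS eqSS; move: (eop_t i) (eop_t1 i) (@eop_col i x); rewrite eqxx => h1 h2 h3.
case: (eqVneq x t) IH h3 => [->|xt] IH h3.
  by move: IH; case: eqP; lia.
case: (eqVneq x t.+1) IH h3 => [->|xt1] IH h3; last by rewrite h3 //; lia.
lia.
Qed.

Lemma frow_eop : frow R t (eop R t m) = i.
Proof.
have [iR _ _ h1 h2] := erowP mR mp; rewrite -/i in iR h1 h2.
apply: last_max_uniq; first exact: ltnW.
- move=> r ri; rewrite /height !psum_eop_t.
  move: (psum_eop_t1 r.+1) (psum_eop_t1 i.+1) (h1 _ ri).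
  by rewrite -/i; case: (ltnP i r.+1) (ltnP i i.+1) (ltnP i r) (ltnP i i) => ? [] ? [] ? [] ? /=; lia.
- move=> r ri _; rewrite /height !psum_eop_t.
  move: (psum_eop_t1 r.+1) (psum_eop_t1 i.+1) (h2 _ ri).
  by rewrite -/i; case: (ltnP i r.+1) (ltnP i i.+1) (ltnP i r) (ltnP i i) => ? [] ? [] ? [] ? /=; lia.
Qed.

Lemma eop_f_defined : 0 < eop R t m (frow R t (eop R t m)) t.
Proof. by rewrite frow_eop eop_t eqxx addn1. Qed.

Lemma eopK : fop R t (eop R t m) = m.
Proof.
apply/funext => r; apply/funext => x; rewrite /fop frow_eop /eop -/i.
have [_ h _ _ _] := erowP mR mp; move: h; rewrite -/i.
case: (eqVneq r i) => [->|_] /=; last lia.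
by case: (eqVneq x t.+1) => [->|_] /=; [rewrite gtn_eqF //; lia | lia].
Qed.

Lemma eps_eop : eps R t (eop R t m) = (eps R t m - 1)%R.
Proof.
have := eps_fop eop_supp eop_f_defined; rewrite eopK; lia.
Qed.

End EOps.

(** Column strictness: in row i+1 the letters up to x end no further right than the letters below x
    do in row i. *)
Definition gt_pattern (mu : nat -> nat) (m : mat) := forall i x,
  mu i.+1 + psum (m i.+1) x.+1 <= mu i + psum (m i) x.

(** Strict maximality at i against i+1 gives fewer letters t+1 in row i+1 than letters t in row i.
    This is the slack for the only inequality that becomes tighter. *)
Lemma fop_gt R t mu m : rowsupp R m -> 0 < m (frow R t m) t ->
  gt_pattern mu m -> gt_pattern mu (fop R t m).
Proof.
move=> mR md gm r x; have [iR h1 h2] := frowP mR md.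
have h := h2 _ (leqnn _); rewrite !psumS /col in h.
have := psum_fop_row md r.+1 x.+1; have := psum_fop_row md r x.
have := gm r x; have := gm r t; set i := frow R t m in h *.
case: (eqVneq r i) => [ri|_] /=; case: (eqVneq x t.+1) => [->|_] /=; try lia.
rewrite -ri in h *; rewrite (gtn_eqF (ltnSn r)) /=.
by move: (psumS (m r.+1) t.+1) (psumS (m r) t); lia.
Qed.

Lemma eop_gt R t mu m : rowsupp R m -> (0 < eps R t m)%R ->
  gt_pattern mu m -> gt_pattern mu (eop R t m).
Proof.
move=> mR mp gm r x; have [iR hi _ h1 h2] := erowP mR mp.
rewrite !(psum_eop_row mR mp); set i := erow R t m in h1 h2 hi *.
have := gm r x; case: (eqVneq r.+1 i) => [ri|_] /=; last lia.
rewrite eqSS; case: (eqVneq x t) => [->|_] /=; last lia.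
(* The first maximum at i means fewer letters t in the row above than letters t+1 in row i. *)
have h := h1 r; rewrite -ri ltnSn !psumS /col in h; have {}h := h isT.
have := gm r t.+1; rewrite ltn_eqF; last by rewrite -ri.
by move: (psumS (m r.+1) t.+1) (psumS (m r) t); lia.
Qed.

(** * Pairs and chains of letters under the operators *)

Definition wpair (P Q : nat -> Prop) (m : mat) (t : nat) := exists r r',
  [/\ r < r', 0 < m r t, 0 < m r' t.+1, P r & Q r'].

Definition pair (m : mat) (t : nat) := exists r r',
  [/\ r < r', 0 < m r t & 0 < m r' t.+1].

Definition chain (m : mat) (t : nat) := exists r r' r'',
  [/\ r < r', r' < r'', 0 < m r t, 0 < m r' t.+1 & 0 < m r'' t.+2].

(** This is what a pair of t-1 and t requires, since its letter t may be replaced by any lower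
    one. *)
Definition keeps_last R t (m : mat) := forall r, 0 < m r t ->
  exists2 r', r <= r' & 0 < fop R t m r' t.

Lemma pairW m t : pair m t <-> wpair (fun _ => True) (fun _ => True) m t.
Proof.
by split=> [[r [r' [h1 h2 h3]]]|[r [r' [h1 h2 h3 _ _]]]]; exists r, r'.
Qed.

Lemma chainWl m t : chain m t <->
  exists2 r, 0 < m r t & wpair (fun r' => r < r') (fun _ => True) m t.+1.
Proof.
split=> [[r [r' [r'' [h1 h2 h3 h4 h5]]]]|[r h3 [r' [r'' [h1 h2 h4 h5 _]]]]].
  by exists r => //; exists r', r''.
by exists r, r', r''.
Qed.

Lemma chainWr m t : chain m t <->
  exists2 r, 0 < m r t.+2 & wpair (fun _ => True) (fun r' => r' < r) m t.
Proof.
split=> [[r [r' [r'' [h1 h2 h3 h4 h5]]]]|[r h3 [r' [r'' [h1 h2 h4 _ h5]]]]].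
  by exists r'' => //; exists r, r'.
by exists r', r'', r.
Qed.

Section FopPairs.
Variables (R t : nat) (m : mat).
Hypotheses (mR : rowsupp R m) (md : 0 < m (frow R t m) t).
Let i := frow R t m.
Let w := fop R t m.

(** If the new t+1 of row i is used, maximality at i yields an old t+1 below the given t and not
    below row i. If the removed t was used, strictness yields another t between row i and the given
    t+1. Monotonicity of P and Q permits both replacements; with them the lemma covers plain pairs
    and chains whose outer letter is fixed. *)
Lemma wpair_fop P Q : (forall r s, r <= s -> P r -> P s) ->
  (forall r s, r <= s -> Q s -> Q r) -> wpair P Q w t <-> wpair P Q m t.
Proof.
move=> Pup Qdn; have [iR h1 h2] := frowP mR md; rewrite -/i in h1 h2.
have ft := fop_t md; have ft1 := fop_t1 R t m; rewrite -/i -/w in ft ft1.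
split=> -[r [r' [rr mr mr' Pr Qr']]].
- have {}mr : 0 < m r t by have := ft r; lia.
  case: (eqVneq r' i) => [e|ri]; last first.
    by exists r, r'; split=> //; move: mr'; rewrite ft1 (negbTE ri) addn0.
  have lt : psum (col m t.+1) r.+1 < psum (col m t.+1) i.+1.
    have ri : r < i by rewrite -e.
    by have := h1 r ri; have := psum_gt (col m t) (leqnn r) ri; rewrite ?colE; lia.
  have [k [rk ki mk]] := psum_ex lt.
  by exists r, k; split=> //; apply: Qdn Qr'; rewrite e.
have wr' : 0 < w r' t.+1 by rewrite ft1; lia.
case: (posnP (w r t)) => [w0|wr]; last by exists r, r'.
have [ei m1] : r = i /\ m r t = 1.
  by have := ft r; rewrite w0; case: eqP => // e; lia.
have lt : psum (col m t) r.+1 < psum (col m t) r'.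
  have := h2 r'; rewrite -ei rr => /(_ isT).
  by have := psum_gt (col m t.+1) (i := r.+1) rr (ltnSn r'); rewrite !(psumS (col m t)) !colE; lia.
have [k [rk kr' mk]] := psum_ex lt.
exists k, r'; split=> //; last by apply: Pup Pr; apply: ltnW.
by have := ft k; rewrite (gtn_eqF (_ : i < k)) /col -?ei // in mk *; lia.
Qed.

Lemma pair_fop : pair w t <-> pair m t.
Proof. by rewrite !pairW; apply: wpair_fop. Qed.

Lemma chain_fop_lo : chain w t <-> chain m t.
Proof.
rewrite !chainWr; have e r : w r t.+2 = m r t.+2 by apply: fop_col; lia.
have Qd q r s : r <= s -> s < q -> r < q by apply: leq_ltn_trans.
by split=> -[r hr h]; exists r; rewrite ?e // in hr *; apply/(wpair_fop (P := fun _ => True) (fun _ _ _ => id) (@Qd r)).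
Qed.

Lemma pair_fop_up : pair m t.+1 -> pair w t.+1.
Proof.
case=> r [r' [h1 h2 h3]]; exists r, r'; split=> //.
  by rewrite /w fop_t1; lia.
by rewrite /w fop_col //; lia.
Qed.

Lemma pair_fop_other y : y != t -> y != t.+1 -> y.+1 != t -> pair m y -> pair w y.
Proof.
move=> n1 n2 n3 [r [r' [h1 h2 h3]]]; exists r, r'; split=> //.
  by rewrite /w fop_col.
by rewrite /w fop_col //; lia.
Qed.

Lemma chain_fop_up : chain m t.+1 -> chain w t.+1.
Proof.
case=> r [r' [r'' [h1 h2 h3 h4 h5]]]; exists r, r', r''; split=> //.
- by rewrite /w fop_t1; lia.
- by rewrite /w fop_col //; lia.
- by rewrite /w fop_col //; lia.
Qed.

(** A new chain starts at the raised letter of row i. If the t+1 of the given pair is above the t+2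
    of that chain, there was a chain at t+1 before; otherwise the old t of row i and the given pair
    form a chain at t. *)
Lemma chain_fop_new : ~ chain m t.+1 -> ~ chain m t -> pair m t.+1 -> ~ chain w t.+1.
Proof.
move=> n1 n0 [q [q' [qq' mq mq']]] [r [r' [r'' [h1 h2 h3 h4 h5]]]].
rewrite /w fop_t1 -/i in h3; rewrite /w fop_col in h4; try lia.
rewrite /w fop_col in h5; try lia.
case: (posnP (m r t.+1)) => [m0|mr]; last by case: n1; exists r, r', r''.
have ri : r = i by move: h3; rewrite m0; case: eqP.
case: (ltnP q r') => [qr|rq]; first by case: n1; exists q, r', r''.
by case: n0; exists i, q, q'; split=> //; lia.
Qed.

Lemma chain_fop_other y : y.+2 < t \/ t.+1 < y -> chain w y <-> chain m y.
Proof.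
move=> hy; split=> -[r [r' [r'' [h1 h2 h3 h4 h5]]]]; exists r, r', r''.
  by move: h3 h4 h5; rewrite /w !fop_col; try lia.
by rewrite /w !fop_col; try lia.
Qed.

End FopPairs.

Lemma chain_fop_mid R t m : rowsupp R m -> 0 < m (frow R t.+1 m) t.+1 ->
  chain (fop R t.+1 m) t <-> chain m t.
Proof.
move=> mR md; rewrite !chainWl.
have e r : fop R t.+1 m r t = m r t by apply: fop_col; lia.
have Pu q r s : r <= s -> q < r -> q < s by move=> h1 h2; apply: leq_trans h1.
by split=> -[r hr h]; exists r; rewrite ?e // in hr *; apply/(wpair_fop mR md (Q := fun _ => True) (@Pu r) (fun _ _ _ => id)).
Qed.

Lemma chain_fop_down R t m : 0 < m (frow R t.+2 m) t.+2 ->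
  chain (fop R t.+2 m) t -> chain m t.
Proof.
move=> md [r [r' [r'' [h1 h2 h3 h4 h5]]]]; exists r, r', r''.
have e x y : x < t.+2 -> fop R t.+2 m y x = m y x by move=> ?; apply: fop_col; lia.
by rewrite -(e t) // -(e t.+1) //; split=> //; have := fop_t md r''; lia.
Qed.

Lemma chain_fop_keep R t m : keeps_last R t.+2 m -> chain m t -> chain (fop R t.+2 m) t.
Proof.
move=> kl [r [r' [r'' [h1 h2 h3 h4 h5]]]]; have [q rq hq] := kl _ h5.
have e x y : x < t.+2 -> fop R t.+2 m y x = m y x by move=> ?; apply: fop_col; lia.
by exists r, r', q; rewrite (e t) // (e t.+1) //; split=> //; lia.
Qed.

Lemma pair_fop_keep R t m : keeps_last R t.+1 m -> pair m t -> pair (fop R t.+1 m) t.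
Proof.
move=> kl [r [r' [h1 h2 h3]]]; have [q rq hq] := kl _ h3.
exists r, q; have -> : fop R t.+1 m r t = m r t by apply: fop_col; lia.
by split=> //; lia.
Qed.

Lemma f_defined_gt R t m : rowsupp R m ->
  psum (col m t.+1) R < psum (col m t) R -> 0 < m (frow R t m) t.
Proof. by move=> mR h; apply: f_defined => //; have := eps_ge0 t mR; lia. Qed.

(** The height at row r is at least 1, which makes up for the missing excess of letters t. *)
Lemma f_defined_eq R t m r : rowsupp R m ->
  psum (col m t.+1) R <= psum (col m t) R -> 0 < m r t.+1 ->
  (forall k, k < r -> m k t = 0) -> 0 < m (frow R t m) t.
Proof.
move=> mR h h1 h2; apply: f_defined => //; have := eps_max t mR r.
by rewrite /height psumS (psum_eq0 h2) ?colE; lia.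
Qed.

Section KeepsLast.
Variables (R t : nat) (m : mat).
Hypotheses (mR : rowsupp R m) (md : 0 < m (frow R t m) t).
Let i := frow R t m.

Lemma last_lost : ~ keeps_last R t m ->
  [/\ i < R, m i t = 1, (forall k, i < k -> m k t = 0) &
      psum (col m t) R = (psum (col m t) i).+1].
Proof.
move=> /existsNP [r /not_implyP[mr hr]]; have [iR _ _] := frowP mR md.
have w0 k : r <= k -> fop R t m k t = 0.
  by move=> rk; case: (posnP (fop R t m k t)) => // h; case: hr; exists k.
have ft k : r <= k -> m k t = (k == i) by move=> rk; rewrite -(fop_t md) w0.
have ri : r = i by move: mr; rewrite ft //; case: eqP.
rewrite ri in ft; have mi : m i t = 1 by rewrite ft ?eqxx.
have m0 k : i < k -> m k t = 0 by move=> ik; rewrite ft ?(ltnW ik) ?gtn_eqF.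
split=> //; rewrite (psum_stable (R := i.+1)) //.
by rewrite psumS colE mi addn1.
Qed.

(** If the lowest t, in row i, were lost, all other letters t would lie above row i, and comparing
    the heights at 0 and i would give at least as many letters t+1. *)
Lemma keeps_last_two :
  (psum (col m t.+1) R).+1 < psum (col m t) R -> keeps_last R t m.
Proof.
move=> h; apply: contrapT => /last_lost[iR mi _ e]; have [_ h1 _] := frowP mR md.
rewrite -/i in h1; case: (posnP i) => [i0|i0]; first by rewrite e i0 psum0 in h; lia.
have := h1 _ i0; rewrite psum0; have := leq_psum (col m t.+1) iR; lia.
Qed.

(** The argument of [keeps_last_two] with the heights compared at r instead of 0: the t+1 in row r,
    with no t above it, improves the bound by 1. *)
Lemma keeps_last_one r :
  psum (col m t.+1) R < psum (col m t) R -> 0 < m r t.+1 ->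
  (forall k, k < r -> m k t = 0) -> keeps_last R t m.
Proof.
move=> h br ar; apply: contrapT => /last_lost[iR mi m0 e].
have [_ h1 _] := frowP mR md; rewrite -/i in h1.
case: (ltngtP r i) => ri.
- have := h1 _ ri; have := leq_psum (col m t.+1) iR.
  by rewrite (psumS _ r) (psum_eq0 ar) ?colE; lia.
- by rewrite ar in mi.
- have := psum_gt (col m t.+1) (leqnn i) iR.
  by rewrite -ri in e *; rewrite (psum_eq0 ar) in e; rewrite ?colE; lia.
Qed.

End KeepsLast.

(** Supplies the row that [f_defined_eq] and [keeps_last_one] ask for: a letter t above the upper
    letter of the pair would complete a chain. *)
Lemma first_free m t : ~ chain m t -> pair m t.+1 ->
  exists2 r, 0 < m r t.+1 & forall k, k < r -> m k t = 0.
Proof.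
move=> nc [r [r' [h1 h2 h3]]]; exists r => // k kr.
by case: (posnP (m k t)) => // mk; case: nc; exists k, r, r'.
Qed.

(* Either the letter moved into column x+1 lies below r1, and then the last x+1
   survives, or it lies above all the others, and then each of those has a
   letter x above it. *)
Lemma fop_fop_pair R x m r1 (w := fop R x m) : rowsupp R m ->
  0 < m (frow R x m) x -> 1 < psum (col m x.+1) R -> 0 < m r1 x.+2 ->
  (forall k, k < r1 -> m k x.+1 = 0) ->
  psum (col m x.+2) R <= psum (col m x.+1) R ->
  0 < w (frow R x.+1 w) x.+1 ->
  keeps_last R x.+1 w \/
  psum (col m x.+1) R < psum (col m x) R /\ pair (fop R x.+1 w) x.
Proof.
move=> mR md c2 hr1 m0 le wd; have wR : rowsupp R w by apply: fop_supp.
have [iR h1 h2] := frowP mR md; set i := frow R x m in iR h1 h2.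
case: (leqP r1 i) => ri.
  left; apply: (keeps_last_one wR wd (r := r1)).
  - by rewrite /w psum_fop_t1 psum_fop ?iR; lia.
  - by rewrite /w fop_col; lia.
  - by move=> k kr; rewrite /w fop_t1 m0 // ltn_eqF //; apply: leq_trans ri.
right; split.
  have := h2 R iR; rewrite (psum_stable (R := R) (R' := R.+1)) //; last by move=> k; apply: mR.
  have -> : psum (col m x.+1) i.+1 = 0 by apply: psum_eq0 => k ki; apply: m0; lia.
  by lia.
have old y : 0 < m y x.+1 -> exists2 k, k < y & 0 < w k x.
  move=> my; have ry : r1 <= y by case: leqP => // /m0 e; rewrite e in my.
  have iy : i < y by apply: leq_trans ry.
  have lt : psum (col w x) i < psum (col w x) y.
    have := psum_fop_t md i; have := psum_fop_t md y; rewrite -/i -/w ltnn iy.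
    have := h2 _ iy; rewrite psumS colE.
    have -> : psum (col m x.+1) i.+1 = 0 by apply: psum_eq0 => k ki; apply: m0; lia.
    rewrite ?colE; lia.
  by have [k [_ ky wk]] := psum_ex lt; exists k.
set v := fop R x.+1 w; pose i' := frow R x.+1 w.
suff [y my vy] : exists2 y, 0 < m y x.+1 & 0 < v y x.+1.
  have [k ky wk] := old y my; exists k, y; split=> //.
  by rewrite /v fop_col //; lia.
apply: contrapT => no; have e y : m y x.+1 <= (y == i').
  case: (posnP (m y x.+1)) => [->//|my].
  have v0 : v y x.+1 = 0 by case: (posnP (v y x.+1)) => // vy; case: no; exists y.
  have := fop_t wd y; rewrite -/v v0 -/i'.
  by rewrite /w fop_t1; lia.
have : psum (col m x.+1) R <= psum (fun y => y == i' : nat) R.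
  by apply: leq_sum => k _; apply: e.
by rewrite psum_delta; lia.
Qed.

(** * Levelling a block of the content *)

Section Block.
Variables (R : nat) (D : nat -> Prop) (lo hi c : nat).
Hypotheses (c1 : 1 < c) (Dblock : forall y, lo <= y < hi -> D y).

(* In state j the letter lo occurs c+1 times, j occurs c-1 times and the other
   letters c times (if j = lo, all occur c times). One step moves the deficit
   from j down to t = select j, the largest t in (lo, j) with a decreasing chain
   t+1, t, t-1 (or lo), by applying f_t, f_(t+1), .., f_(j-1). The step creates
   no chain at y for t <= y < j-1 and keeps the one at j-1, so that j can be
   recovered from t: this is the function [next]. *)
Record bstate (j : nat) (m : mat) : Prop := BState {
  bs_supp : rowsupp R m;
  bs_pair : forall y, D y -> pair m y;
  bs_cont : forall y, lo <= y <= hi ->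
    psum (col m y) R + (y == j) = c + (y == lo);
  bs_top : lo < j -> j < hi -> chain m j.-1 }.

Fixpoint fsteps (t d : nat) (m : mat) : mat :=
  if d is d'.+1 then fop R (t + d') (fsteps t d' m) else m.

Fixpoint esteps (t d : nat) (m : mat) : mat :=
  if d is d'.+1 then esteps t d' (eop R (t + d') m) else m.

Section Move.
Variables (j t : nat) (m : mat).
Hypotheses (lot : lo <= t) (tj : t < j) (jhi : j <= hi) (S : bstate j m).
Hypothesis nochain : forall y, t <= y -> y.+1 < j -> ~ chain m y.
Hypothesis selected : lo < t -> chain m t.-1.

(** The state after f_t, .., f_(t+d-1): a surplus has travelled from t to t+d, while j still lacks a
    letter. [bi_def], [bi_keep] and [bi_keep1] speak of the next operator because [fop_fop_pair]
    derives them using the state before the previous one. [bi_keep1] protects the selected chain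
    t-1, t, t+1 against f_(t+1). *)
Record binv (d : nat) (w : mat) : Prop := BInv {
  bi_supp : rowsupp R w;
  bi_pair : forall y, D y -> pair w y;
  bi_cont : forall y, lo <= y <= hi ->
    psum (col w y) R + (y == j) + (y == t) = c + (y == lo) + (y == t + d);
  bi_nochain : forall y, t <= y -> y.+1 < j -> ~ chain w y;
  bi_top : j < hi -> chain w j.-1;
  bi_sel : lo < t -> chain w t.-1;
  bi_def : t + d < j -> 0 < w (frow R (t + d) w) (t + d);
  bi_keep : t + d < j -> 0 < t + d -> D (t + d).-1 -> pair (fop R (t + d) w) (t + d).-1;
  bi_keep1 : d = 1 -> t + d < j -> lo < t -> keeps_last R (t + d) w }.

(** If t+1 < j, f_t is defined because there is no chain at t; if t+1 = j, because of the deficit at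
    j. The pair t-1, t is protected by the selected chain if lo < t, and by the extra letter if t =
    lo. *)
Lemma binv0 : binv 0 m.
Proof.
have [mR mp mc mt] := S.
have ct := mc t ltac:(lia).
have free : t.+1 < j -> exists2 r, 0 < m r t.+1 & forall k, k < r -> m k t = 0.
  move=> tj1; apply: first_free; first by apply: nochain; lia.
  by apply/mp/Dblock; lia.
have ct1 := mc t.+1 ltac:(lia).
have df : 0 < m (frow R t m) t.
  case: (ltnP t.+1 j) => tj1; last by apply: f_defined_gt => //; lia.
  by have [r hr h0] := free tj1; apply: (f_defined_eq mR _ hr h0); lia.
split=> //; rewrite ?addn0 //.
- by move=> y; have := mc y; lia.
- by move=> h; apply: mt => //; lia.
move=> _ t0 Dt; have [t' e] : exists t', t = t'.+1 by exists t.-1; lia.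
case: (ltngtP lo t) lot => // lt _.
  have := selected lt; rewrite e /= in df *.
  by case/(chain_fop_mid mR df) => [r [r' [r'' [h1 h2 h3 h4 h5]]]]; exists r, r'.
have kl : keeps_last R t m.
  case: (ltnP t.+1 j) => tj1; last by apply: keeps_last_two => //; lia.
  by have [r hr h0] := free tj1; apply: (keeps_last_one mR df _ hr h0); lia.
have := mp _ Dt; rewrite e /= in kl *; exact: pair_fop_keep.
Qed.

Lemma binvS d w : binv d w -> t + d < j -> binv d.+1 (fop R (t + d) w).
Proof.
case=> wR wp wc wn wt ws wd wk wk1 dj; set x := t + d in wd wk wk1 wc dj *.
have md := wd dj; set w' := fop R x w.
have w'R : rowsupp R w' by apply: fop_supp.
have wc' y : lo <= y <= hi -> psum (col w' y) R + (y == j) + (y == t) =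
    c + (y == lo) + (y == x.+1).
  move=> hy; have [iR _ _] := frowP wR md; have := wc y hy.
  case: (eqVneq y x) => [->|nx].
    by have := psum_fop_t md R; rewrite -/w' iR; lia.
  case: (eqVneq y x.+1) => [->|nx1].
    by rewrite /w' psum_fop_t1 iR; lia.
  by rewrite /w' psum_fop //; lia.
have wp' y : D y -> pair w' y.
  move=> Dy; have py := wp y Dy.
  case: (eqVneq y x) => [e|nx]; first by rewrite e in py *; apply/pair_fop.
  case: (eqVneq y x.+1) => [yx|nx1]; first by rewrite yx; apply: pair_fop_up => //; rewrite -yx.
  case: (eqVneq y.+1 x) => [yx|nx2]; last by apply: pair_fop_other.
  have x0 : 0 < x by rewrite -yx.
  by have e : x.-1 = y; [rewrite -yx | have := wk dj x0; rewrite e; apply].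
(* The letter x+1 now occurs c+1 times. If x+2 = j, the excess is two. Otherwise the absence of a
   chain at x+1 gives the free letter x+2 that [fop_fop_pair] requires, and 1 < c gives its bound on
   the number of letters x+1. *)
have key : x.+1 < j -> 0 < w' (frow R x.+1 w') x.+1 /\
   (keeps_last R x.+1 w' \/ c < psum (col w x) R /\ pair (fop R x.+1 w') x).
  move=> xj; have cx := wc' x.+1 ltac:(lia).
  have cx1 := wc' x.+2; have df : 0 < w' (frow R x.+1 w') x.+1.
    by apply: f_defined_gt => //; lia.
  split=> //; case: (ltnP x.+2 j) => xj2; last by left; apply: keeps_last_two => //; lia.
  have nx : ~ chain w x.+1 by apply: wn => //; rewrite /x; clear; lia.
  have [r hr h0] : exists2 r, 0 < w r x.+2 & forall k, k < r -> w k x.+1 = 0.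
    by apply: first_free => //; apply/wp/Dblock; clear -lot jhi xj xj2; lia.
  have e1 := wc x.+1 ltac:(lia); have e2 := wc x.+2 ltac:(lia).
  case: (fop_fop_pair wR md _ hr h0 _ df); [lia | lia | by left | move=> -[h1 h2]; right; split=> //; lia].
split=> //; rewrite ?addnS -/x //.
- move=> y ty yj; have ny := wn y ty yj.
  case: (eqVneq y x) => [yx|nx]; first by rewrite yx in ny *; move/(chain_fop_lo wR md).
  case: (eqVneq y x.+1) => [yx|nx1].
    rewrite yx in ny yj *; apply: chain_fop_new => //; first by apply: wn; lia.
    by apply/wp/Dblock; lia.
  case: (eqVneq y.+1 x) => [yx|nx2].
    by rewrite /w' -yx in md * => /(chain_fop_mid wR md).
  case: (eqVneq y.+2 x) => [yx|nx3].
    by rewrite /w' -yx in md * => /(chain_fop_down md).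
  have far : y.+2 < x \/ x.+1 < y by lia.
  by move/(chain_fop_other md far).
- move=> jh; have ct := wt jh; case: (eqVneq x j.-1) => [e|ne].
    by rewrite -e in ct *; apply/(chain_fop_lo wR md).
  case: (eqVneq x.+1 j.-1) => [e|ne1].
    by rewrite -e in ct *; apply: chain_fop_up.
  by apply/(chain_fop_other md) => //; right; lia.
(* Only f_t and f_(t+1) change the letters of the selected chain t-1, t, t+1: the first always
   preserves its existence, the second by [bi_keep1]. *)
- move=> lt; have ct := ws lt; have t0 : 0 < t by lia.
  case: (eqVneq d 0) => [d0|dn0].
    have ex : x = t.-1.+1 by rewrite /x; lia.
    by rewrite /w' ex in md *; apply/(chain_fop_mid wR md).
  case: (eqVneq d 1) => [d1|dn1].
    have ex : x = t.-1.+2 by rewrite /x; lia.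
    by have := wk1 d1 dj lt; rewrite /w' ex => /chain_fop_keep; apply.
  by apply/(chain_fop_other md) => //; left; rewrite /x; lia.
- by move=> h; case: (key h).
- move=> h _ Dx /=; case: (key h) => df [kl|[_ //]].
  by apply: pair_fop_keep => //; apply: wp'.
(* The second alternative of [key] asks for more than c letters t before f_t, but t is not lo and
   occurs exactly c times. *)
- move=> [d0] h lt; case: (key h) => df [//|[h1 _]].
  by have := wc x; rewrite /x d0 addn0 in h1 *; lia.
Qed.

Lemma binv_steps d : t + d <= j -> binv d (fsteps t d m).
Proof.
elim: d => [|d IH] h; first exact: binv0.
by apply: binvS; [apply: IH; lia | lia].
Qed.

Let w := fsteps t (j - t) m.

Lemma move_bstate : bstate t w.
Proof.
have [wR wp wc wn wt ws _ _ _] := @binv_steps (j - t) ltac:(lia).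
split=> // [y hy|h _]; last exact: ws.
by have := wc y hy; rewrite subnKC ?(ltnW tj) // -/w; lia.
Qed.

Lemma move_nochain y : t <= y -> y.+1 < j -> ~ chain w y.
Proof. exact: (bi_nochain (@binv_steps (j - t) ltac:(lia))). Qed.

Lemma move_top : j < hi -> chain w j.-1.
Proof. exact: (bi_top (@binv_steps (j - t) ltac:(lia))). Qed.

Lemma fstepsK d : t + d <= j -> esteps t d (fsteps t d m) = m.
Proof.
elim: d => //= d IH h; have [wR _ _ _ _ _ wd _ _] := @binv_steps d ltac:(lia).
by rewrite fopK ?IH //; try apply: wd; lia.
Qed.

Lemma move_closed (P : mat -> Prop) :
  (forall x w, lo <= x < hi -> rowsupp R w -> 0 < w (frow R x w) x ->
     P w -> P (fop R x w)) -> P m -> P w.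
Proof.
move=> Pf Pm; have : t + (j - t) <= j by lia.
rewrite /w; elim: (j - t) => //= d IH h.
have [wR _ _ _ _ _ wd _ _] := @binv_steps d ltac:(lia).
by apply: Pf => //; [lia | apply: wd; lia | apply: IH; lia].
Qed.

End Move.

Fixpoint select (m : mat) (j : nat) : nat :=
  if j is j'.+1 then
    if j' <= lo then lo else if `[< chain m j'.-1 >] then j' else select m j'
  else lo.

Lemma selectP m j (t := select m j) : lo < j ->
  [/\ lo <= t, t < j, lo < t -> chain m t.-1 &
      forall y, t <= y -> y.+1 < j -> ~ chain m y].
Proof.
rewrite {}/t; elim: j => //= j IH; rewrite ltnS leq_eqVlt => /orP[/eqP<-|lj].
  by rewrite leqnn; split=> //; lia.
rewrite (ltn_geF lj); case: asboolP => ch.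
  by split=> //; [lia | move=> y; lia].
have [h1 h2 h3 h4] := IH lj; split=> //; first by apply: ltnW.
move=> y ty yj; case: (eqVneq y.+1 j) => [e|ne]; first by rewrite -e in ch.
by apply: h4 => //; lia.
Qed.

(** Here d bounds the search: with t + d + 1 = hi, a search that finds no chain returns hi, the
    initial state, which no chain marks. *)
Fixpoint next (m : mat) (d t : nat) : nat :=
  if d is d'.+1 then if `[< chain m t >] then t.+1 else next m d' t.+1 else t.+1.

Lemma nextP m d t j : t + d.+1 = hi -> t < j -> j <= hi ->
  (forall y, t <= y -> y.+1 < j -> ~ chain m y) -> (j < hi -> chain m j.-1) ->
  next m d t = j.
Proof.
elim: d t => [|d IH] t hd tj jh nc ct /=; first by lia.
case: (eqVneq t.+1 j) => [e|ne].
  by rewrite asboolT // -[t]/(t.+1.-1) e; apply: ct; lia.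
rewrite asboolF; last by apply: nc; lia.
by apply: IH => //; try lia; move=> y ty; apply: nc; lia.
Qed.

(** The argument n is fuel; every step lowers j, so j - lo is enough. *)
Fixpoint bmap (n j : nat) (m : mat) : mat :=
  if n is n'.+1 then
    if j <= lo then m else let t := select m j in bmap n' t (fsteps t (j - t) m)
  else m.

Fixpoint bunmap (n t : nat) (w : mat) : mat :=
  if n is n'.+1 then
    if hi <= t then w else
    let j := next w (hi - t).-1 t in bunmap n' j (esteps t (j - t) w)
  else w.

Lemma bmap_spec n j m : lo <= j <= hi -> j - lo <= n -> bstate j m ->
  [/\ bstate lo (bmap n j m),
      (forall P : mat -> Prop, (forall x w, lo <= x < hi -> rowsupp R w ->
         0 < w (frow R x w) x -> P w -> P (fop R x w)) -> P m -> P (bmap n j m)) &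
      exists k, forall N, bunmap (k + N) lo (bmap n j m) = bunmap N j m].
Proof.
elim: n j m => [|n IH] j m /andP[lj jh] hn S /=.
  have e : j = lo by lia.
  by rewrite e in S *; split=> //; exists 0.
case: (leqP j lo) => [jl|jl].
  have e : j = lo by lia.
  by rewrite e in S *; split=> //; exists 0.
have [lt tj sel nc] := selectP m jl; set t := select m j in lt tj sel nc *.
have St := move_bstate lt tj jh S nc sel.
have [h1 h2 [k hk]] := IH t _ ltac:(lia) ltac:(lia) St.
split=> // [P Pf Pm|]; first by apply: h2 => //; apply: (move_closed lt tj jh S nc sel).
exists k.+1 => N; rewrite addSnnS hk /= (ltn_geF (leq_trans tj jh)).
have -> : next (fsteps t (j - t) m) (hi - t).-1 t = j.
  apply: nextP => //; try lia.
  - exact: (move_nochain lt tj jh S nc sel).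
  - exact: (move_top lt tj jh S nc sel).
by rewrite (fstepsK lt tj jh S nc sel) // subnKC // ltnW.
Qed.

Lemma bmap_inj n m m' : lo <= hi -> hi - lo <= n -> bstate hi m -> bstate hi m' ->
  bmap n hi m = bmap n hi m' -> m = m'.
Proof.
move=> lh hn S S' e.
have [_ _ [k hk]] := bmap_spec (n := n) (j := hi) (m := m) ltac:(lia) hn S.
have [_ _ [k' hk']] := bmap_spec (n := n) (j := hi) (m := m') ltac:(lia) hn S'.
have un N w : bunmap N hi w = w by case: N => //= N; rewrite leqnn.
by have := hk k'; have := hk' k; rewrite !un e addnC => ->.
Qed.

End Block.

(** * Alternants *)

Section Alternant.
Variable n : nat.
Implicit Types (a v kappa : {ffun 'I_n -> nat}) (w : {perm 'I_n}).
Import GRing.Theory Num.Theory.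

Definition delta (k : 'I_n) : nat := n - k.+1.

Definition pact a w : {ffun 'I_n -> nat} := [ffun k => a (w k)].

Definition dominant a := forall j j' : 'I_n, j' = j.+1 :> nat -> a j' <= a j.

Definition adj_sym (chi : {ffun 'I_n -> nat} -> rat) :=
  forall j j' : 'I_n, j' = j.+1 :> nat -> forall a, chi (pact a (tperm j j')) = chi a.

(* The coefficient of x^(kappa+delta) in the product of chi and the Vandermonde
   determinant. *)
Definition alternant (chi : {ffun 'I_n -> nat} -> rat) kappa : rat :=
  (\sum_(w : {perm 'I_n}) (-1) ^+ w *
    (if [forall k, (delta (w k) <= kappa k + delta k)%N]
     then chi [ffun k => (kappa k + delta k - delta (w k))%N] else 0))%R.

Lemma alternant_sum (I : Type) (r : seq I) (c : I -> rat) chi kappa :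
  (alternant (fun a => \sum_(i <- r) c i * chi i a) kappa =
   \sum_(i <- r) c i * alternant (chi i) kappa)%R.
Proof.
under eq_bigr do rewrite big_distrr /=.
rewrite exchange_big /=; apply: eq_bigr => w _.
case: ifP => _; last by rewrite mulr0 big1 // => i _; rewrite !mulr0.
by rewrite big_distrr /=; apply: eq_bigr => i _; rewrite mulrCA.
Qed.

Lemma pactM a w1 w2 : pact a (w1 * w2)%g = pact (pact a w2) w1.
Proof. by apply/ffunP => k; rewrite !ffunE permM. Qed.

Lemma adj_sym_perm chi : adj_sym chi -> forall w a, chi (pact a w) = chi a.
Proof.
move=> sy; have tp d (i j : 'I_n) : i < j -> j = i + d.+1 :> nat ->
    forall a, chi (pact a (tperm i j)) = chi a.
  elim: d i => [|d IH] i ij jd a; first by apply: sy; rewrite jd addn1.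
  have lt : i.+1 < n by apply: leq_trans (ltn_ord j); lia.
  pose i' := Ordinal lt.
  have ni : i != i' by rewrite -val_eqE /=; lia.
  have nj : j != i' by rewrite -val_eqE /=; lia.
  have nij : i != j by rewrite -val_eqE /=; lia.
  (* Conjugation by an adjacent transposition brings the two indices closer. *)
  have -> : tperm i j = (tperm i i' * tperm i' j * tperm i i')%g.
    rewrite -{1}(tpermV i i') -mulgA -/(conjg _ _) tpermJ tpermR.
    by rewrite tpermD // 1?eq_sym.
  rewrite !pactM sy //= IH ?sy //=; lia.
move=> w; have [ts -> _] := prod_tpermP w.
elim: ts => [|[x y] ts IH] a /=.
  by rewrite big_nil; congr chi; apply/ffunP => k; rewrite ffunE perm1.
rewrite big_cons pactM /=; case: (ltngtP x y) => xy.
- by rewrite (tp (y - x).-1) ?IH //; lia.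
- by rewrite tpermC (tp (x - y).-1) ?IH //; lia.
- rewrite (val_inj xy) tperm1 -[RHS]IH; congr chi.
  by apply/ffunP => k; rewrite !ffunE perm1.
Qed.

Lemma incr_perm1 w : (forall i j : 'I_n, i < j -> w i < w j) -> w = 1%g.
Proof.
have ge (u : {perm 'I_n}) : (forall i j : 'I_n, i < j -> u i < u j) ->
    forall k : 'I_n, k <= u k.
  move=> mono [k kn]; elim: k kn => //= k IH kn.
  by have := mono (Ordinal (ltnW kn)) (Ordinal kn) (leqnn _); have := IH (ltnW kn); lia.
move=> mono; apply/permP => k; rewrite perm1; apply/val_inj/anti_leq.
rewrite ge //= andbT -{2}(permK w k); apply: ge => i j ij.
case: (ltngtP (w^-1%g i) (w^-1%g j)) => // [/mono|/val_inj e]; rewrite ?permKV; first lia.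
by move: ij; rewrite (perm_inj e) ltnn.
Qed.

Lemma strict_dec v : (forall j j' : 'I_n, j' = j.+1 :> nat -> v j' < v j) ->
  forall i j : 'I_n, i < j -> v j < v i.
Proof.
move=> dec i [j jn] /=; elim: j jn => // j IH jn; rewrite ltnS leq_eqVlt => /orP[/eqP e|ij].
  by apply: dec; rewrite /= e.
by apply: leq_trans (IH (ltnW jn) ij); apply/ltnW/dec.
Qed.

Definition shift a : {ffun 'I_n -> nat} := [ffun k => a k + delta k].

Lemma shift_dec a : dominant a ->
  forall i j : 'I_n, i < j -> shift a j < shift a i.
Proof.
move=> da; apply: strict_dec => j j' e; rewrite !ffunE /delta e.
by have := da _ _ e; have := ltn_ord j'; rewrite e; lia.
Qed.

Definition weight_sum a := \sum_k a k.
Definition height_sum a := \sum_k a k * delta k.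

Lemma height_sum_le a : height_sum a <= weight_sum a * n.
Proof.
rewrite /weight_sum big_distrl; apply: leq_sum => k _.
by rewrite leq_mul2l leq_subr orbT.
Qed.

(** The strict rearrangement inequality, from 2xy <= x^2 + y^2 with equality only for x = y. *)
Lemma delta_perm w : w != 1%g ->
  \sum_k delta (w k) * delta k < \sum_k delta k * delta k.
Proof.
move=> w1; have [k0 hk0] : exists k, w k != k.
  apply/existsP; apply: contraR w1 => /existsPn h; apply/eqP/permP => k.
  by rewrite perm1; apply/eqP/negbNE/h.
rewrite -(ltn_pmul2l (isT : 0 < 2)) big_distrr /=.
have -> : 2 * (\sum_k delta k * delta k) = \sum_k (delta (w k) ^ 2 + delta k ^ 2).
  rewrite big_split /= -(reindex_inj (@perm_inj _ w) (P := xpredT) (F := fun k => delta k ^ 2)).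
  by rewrite mul2n -addnn.
rewrite (bigD1 k0) //= [X in _ < X](bigD1 k0) //= -addSn; apply: leq_add.
  rewrite ltn_neqAle (nat_Cauchy _ _) (nat_Cauchy _ _) andbT; apply/eqP => e.
  case/eqP: hk0; apply: val_inj; move: e; rewrite /delta /=.
  by have := ltn_ord k0; have := ltn_ord (w k0); lia.
by apply: leq_sum => k _; rewrite (nat_Cauchy _ _).
Qed.

Lemma height_sum_swap a (j j' : 'I_n) : j' = j.+1 :> nat -> a j < a j' ->
  height_sum a < height_sum (pact a (tperm j j')).
Proof.
move=> e lt; have nj : j' != j by rewrite -val_eqE /= e; lia.
have spl b : height_sum b = b j * delta j + (b j' * delta j' +
    \sum_(k | (k != j) && (k != j')) b k * delta k).
  by rewrite /height_sum (bigD1 j) //= (bigD1 j').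
rewrite !spl !ffunE tpermL tpermR.
rewrite [X in _ < _ + (_ + X)](eq_bigr (fun k => a k * delta k)) => [|k /andP[k1 k2]].
  rewrite !addnA ltn_add2r /delta e; have := ltn_ord j'; rewrite e => jn.
  have -> : n - j.+1 = (n - j.+2).+1 by lia.
  by rewrite !mulnS; lia.
by rewrite ffunE tpermD // eq_sym.
Qed.

(** Descending induction on [height_sum], which is at most N n. For dominant a the identity
    contributes chi a to the alternant, and every other exponent has a larger [height_sum] by
    rearrangement; for other a an adjacent swap increases it. *)
Lemma alternant_uniq chi N : adj_sym chi ->
  (forall a, chi a != 0%R -> weight_sum a = N) ->
  (forall kappa, dominant kappa -> alternant chi kappa = 0%R) ->
  forall a, chi a = 0%R.
Proof.
move=> sy su al a; have [d] := ubnP (N * n - height_sum a); elim: d a => // d IH a.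
rewrite ltnS => hd; apply/eqP/negPn/negP => ca; have sa := su _ ca.
have big b : weight_sum b = N -> height_sum a < height_sum b -> chi b = 0%R.
  move=> sb lt; apply: IH; have := height_sum_le b; rewrite sb; lia.
case: (pselect (dominant a)) => [da|].
  have := al _ da; rewrite /alternant (bigD1 1%g) //= odd_perm1 expr0 mul1r.
  rewrite ifT; last by apply/forallP => k; rewrite perm1 leq_addl.
  rewrite big1 ?addr0 => [|w w1].
    rewrite (_ : [ffun _ => _] = a); first by move=> e; rewrite e eqxx in ca.
    by apply/ffunP => k; rewrite ffunE perm1 addnK.
  case: ifP => [/forallP h|_]; last by rewrite mulr0.
  set b := [ffun _ => _].
  have eb k : b k + delta (w k) = a k + delta k by rewrite ffunE subnK.
  rewrite big ?mulr0 //.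
    have : weight_sum b + \sum_k delta (w k) = weight_sum a + \sum_k delta k.
      by rewrite /weight_sum -!big_split; apply: eq_bigr => k _; apply: eb.
    by rewrite -(reindex_inj (@perm_inj _ w) (P := xpredT) (F := delta)) sa => /addIn.
  have : height_sum b + \sum_k delta (w k) * delta k =
         height_sum a + \sum_k delta k * delta k.
    by rewrite /height_sum -!big_split; apply: eq_bigr => k _ /=; rewrite -!mulnDl eb.
  by have := delta_perm w1; lia.
move=> /existsNP[j /existsNP[j' /not_implyP[e /negP]]]; rewrite -ltnNge => lt.
case/eqP: ca; rewrite -(sy _ _ e); apply: big; last exact: height_sum_swap.
rewrite -sa /weight_sum [RHS](reindex_inj (@perm_inj _ (tperm j j'))).
by apply: eq_bigr => k _; rewrite ffunE.
Qed.

Section Character.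
Variables (T : finType) (X : {set T}) (wt : T -> {ffun 'I_n -> nat}).

Definition character a : rat := (#|[set x in X | wt x == a]|%:R)%R.

Variables (I : finType) (cls : T -> option I).
Hypothesis sym : adj_sym character.
Hypothesis cls_sym : forall i, (exists2 x, x \in X & cls x = Some i) ->
  exists j j' : 'I_n, j' = j.+1 :> nat /\ forall v,
  #|[set x in X | (cls x == Some i) && (shift (wt x) == pact v (tperm j j'))]| =
  #|[set x in X | (cls x == Some i) && (shift (wt x) == v)]|.
Hypothesis cls_dom : forall x, x \in X -> cls x = None -> dominant (wt x).

(** The sign-reversing argument in terms of counts: within a class [Some i] a swap of two exponents
    keeps the counts and flips the sign, so the class contributes S = -S. In the class [None] the
    shifted weights are strictly decreasing, and only the identity permutation meets them. *)
Lemma alternant_character kappa : dominant kappa ->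
  alternant character kappa =
    (#|[set x in X | (cls x == None) && (wt x == kappa)]|%:R)%R.
Proof.
move=> dk; pose ind (x : T) v : rat := ((shift (wt x) == v)%:R)%R.
(* By symmetry of the character, w can be moved from delta to kappa + delta, which leaves a sum over
   single elements of X. *)
have -> : (alternant character kappa =
    \sum_(x in X) \sum_w (-1) ^+ odd_perm w * ind x (pact (shift kappa) w))%R.
  rewrite exchange_big /= [RHS](reindex_inj (@invg_inj _)) /=.
  apply: eq_bigr => w _; rewrite odd_permV -big_distrr /=; congr (_ * _)%R.
  case: ifP => [/forallP h|/forallPn[k hk]]; last first.
    rewrite big1 // => x _; rewrite /ind; case: eqP => // /ffunP/(_ (w k)).
    by rewrite !ffunE permK => e; case/negP: hk; rewrite -e leq_addl.
  rewrite -(adj_sym_perm sym w^-1) /character -sum1_card natr_sum big_mkcond /=.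
  rewrite [RHS]big_mkcond /=; apply: eq_bigr => x _; rewrite inE.
  case: (x \in X) => //=; rewrite /ind.
  suff -> : (wt x == pact [ffun k => kappa k + delta k - delta (w k)] w^-1) =
            (shift (wt x) == pact (shift kappa) w^-1) by case: ifP.
  apply/eqP/eqP => /ffunP e; apply/ffunP => k; have := e k.
    rewrite !ffunE permKV => ->; rewrite subnK //.
    by have := h (w^-1%g k); rewrite permKV.
  by rewrite !ffunE permKV => <-; rewrite addnK.
rewrite (bigID (fun x => cls x == None)) /= [X in (_ + X)%R](_ : _ = 0%R) ?addr0.
  rewrite -sum1_card natr_sum big_mkcond [RHS]big_mkcond /=.
  apply: eq_bigr => x _; rewrite inE; case: (boolP (x \in X)) => //= xX.
  case: eqP => //= cx; have dx := shift_dec (cls_dom xX cx).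
  rewrite (bigD1 1%g) //= odd_perm1 expr0 mul1r big1 ?addr0 => [|w w1].
    rewrite /ind; have -> : (shift (wt x) == pact (shift kappa) 1) = (wt x == kappa).
      apply/eqP/eqP => /ffunP e; apply/ffunP => k; have := e k.
        by rewrite !ffunE perm1 => /addIn.
      by rewrite !ffunE perm1 => ->.
    by case: ifP.
  rewrite /ind; case: eqP => [/ffunP e|_]; last by rewrite mulr0.
  case/eqP: w1; apply: incr_perm1 => i j ij; have := dx _ _ ij; rewrite !e !ffunE.
  case: (ltngtP (w i) (w j)) => // [/(shift_dec dk)|/val_inj->]; last by rewrite ltnn.
  by rewrite !ffunE; lia.
rewrite (partition_big cls (fun o => o != None)) //= => [|x /andP[]//].
apply: big1 => -[i|//] _; case: (pselect (exists2 x, x \in X & cls x = Some i)); last first.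
  move=> no; apply: big1 => x /andP[/andP[xX _] /eqP cx]; by case: no; exists x.
case/cls_sym=> j [j' [e N_sym]].
set S := (X in X = _).
have eS : (S = \sum_w (-1) ^+ odd_perm w *
   #|[set x in X | (cls x == Some i) && (shift (wt x) == pact (shift kappa) w)]|%:R)%R.
  rewrite /S exchange_big /=; apply: eq_bigr => w _; rewrite -big_distrr /=.
  congr (_ * _)%R; rewrite -sum1_card natr_sum big_mkcond [RHS]big_mkcond /=.
  apply: eq_bigr => x _; rewrite inE; case: (x \in X) => //=.
  case: (cls x =P Some i) => [->|_]; rewrite ?andbF //= /ind; by case: ifP.
have nj : j != j' by rewrite -val_eqE /= e; lia.
have : (S = - S)%R.
  rewrite {1}eS (reindex_inj (mulgI (tperm j j'))) /= eS -sumrN.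
  apply: eq_bigr => w _; rewrite odd_permM odd_tperm nj signr_addb mulN1r mulNr.
  by rewrite pactM N_sym.
move/eqP; rewrite -addr_eq0 -mulr2n mulrn_eq0 /= => /eqP//.
Qed.

End Character.
End Alternant.

(** * Counting matrices by injections *)

Definition boxed R n B (m : mat) :=
  [/\ rowsupp R m, (forall r x, n <= x -> m r x = 0) & forall r x, m r x <= B].

Section Encode.
Variables R n B : nat.

Definition code := {ffun 'I_R * 'I_n -> 'I_B.+1}.

Definition decode (d : code) : mat := fun r x =>
  if insub r is Some r' then if insub x is Some x' then val (d (r', x')) else 0
  else 0.

Definition encode (m : mat) : code := [ffun p : 'I_R * 'I_n => inord (m p.1 p.2)].

Lemma decodeE d (r : 'I_R) (x : 'I_n) : decode d r x = d (r, x).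
Proof. by rewrite /decode !valK. Qed.

Lemma decode_boxed d : boxed R n B (decode d).
Proof.
rewrite /decode; split=> [r x hr|r x hx|r x].
- by rewrite insubF // ltnNge hr.
- by case: insubP => // r' _ _; rewrite insubF // ltnNge hx.
- by case: insubP => // r' _ _; case: insubP => // x' _ _; rewrite -ltnS ltn_ord.
Qed.

Lemma decodeK d : encode (decode d) = d.
Proof. by apply/ffunP => -[r x]; rewrite ffunE decodeE inord_val. Qed.

Lemma encodeK m : boxed R n B m -> decode (encode m) = m.
Proof.
case=> h1 h2 h3; apply/funext => r; apply/funext => x; rewrite /decode.
case: insubP => [r' _ <-|]; last by rewrite -leqNgt => /h1->.
case: insubP => [x' _ <-|]; last by rewrite -leqNgt => /h2->.
by rewrite ffunE /= inordK // ltnS.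
Qed.

(** Matrices are functions on all of nat, so they are counted inside a finite box, chosen in each
    use large enough to hold every matrix concerned. *)
Definition mcount (P : mat -> Prop) : nat := #|[set d : code | `[< P (decode d) >]]|.

End Encode.

Lemma mcount_le R n B R' n' B' (P Q : mat -> Prop) (F : mat -> mat) :
  (forall m, boxed R n B m -> P m -> boxed R' n' B' (F m) /\ Q (F m)) ->
  (forall m m', boxed R n B m -> P m -> boxed R n B m' -> P m' -> F m = F m' -> m = m') ->
  mcount R n B P <= mcount R' n' B' Q.
Proof.
move=> hF Finj.
rewrite /mcount -(card_in_imset (f := fun d => encode R' n' B' (F (decode d)))).
  apply/subset_leq_card/subsetP => _ /imsetP[d dP ->]; rewrite !inE in dP *.
  have [b q] := hF _ (decode_boxed d) (asboolW dP).
  by apply/asboolP; rewrite encodeK.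
move=> d d'; rewrite !inE => /asboolP dP /asboolP dP' e.
have bd := decode_boxed d; have bd' := decode_boxed d'.
have [b _] := hF _ bd dP; have [b' _] := hF _ bd' dP'.
rewrite -(decodeK d) -(decodeK d'); congr encode; apply: Finj => //.
by rewrite -(encodeK b) e (encodeK b').
Qed.

(** * Reflection of truncated strings *)

Definition colsum R (m : mat) x := psum (col m x) R.

Section Strings.
Variables (R t e0 : nat) (C : mat -> Prop).
Hypothesis C_supp : forall m, C m -> rowsupp R m.
Hypothesis C_eps : forall m, C m -> (e0%:Z <= eps R t m)%R.
Hypothesis C_f : forall m, C m -> 0 < m (frow R t m) t -> C (fop R t m).
Hypothesis C_e : forall m, C m -> (e0%:Z < eps R t m)%R -> C (eop R t m).

Lemma fop_iter k m (w := iter k (fop R t) m) : C m ->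
  ((k + colsum R m t.+1)%:Z <= (colsum R m t)%:Z + eps R t m)%R ->
  [/\ C w, colsum R w t + k = colsum R m t, colsum R w t.+1 = colsum R m t.+1 + k,
      (forall x, x != t -> x != t.+1 -> colsum R w x = colsum R m x) &
      eps R t w = (eps R t m + k%:Z)%R /\ iter k (eop R t) w = m].
Proof.
rewrite {}/w; elim: k => [|k IH] Cm h.
  by split=> //=; rewrite ?addn0 //; split=> //; lia.
have [Cw e1 e2 e3 [e4 e5]] := IH Cm ltac:(lia).
set w := iter k _ m in Cw e1 e2 e3 e4 e5.
have wR := C_supp Cw; have df : 0 < w (frow R t w) t.
  by apply: f_defined => //; rewrite -/(colsum R w t) -/(colsum R w t.+1); lia.
have [iR _ _] := frowP wR df; rewrite iterS -/w.
split.
- exact: C_f.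
- by have := psum_fop_t df R; rewrite iR /colsum in e1 *; lia.
- by rewrite /colsum psum_fop_t1 iR; rewrite /colsum in e2; lia.
- by move=> x n1 n2; rewrite /colsum psum_fop //; apply: e3.
- by rewrite iterSr fopK // eps_fop // e4; split=> //; lia.
Qed.

Lemma eop_iter k m (w := iter k (eop R t) m) : C m ->
  ((k + e0)%:Z <= eps R t m)%R ->
  [/\ C w, colsum R w t = colsum R m t + k, colsum R w t.+1 + k = colsum R m t.+1,
      (forall x, x != t -> x != t.+1 -> colsum R w x = colsum R m x) &
      eps R t w = (eps R t m - k%:Z)%R /\ iter k (fop R t) w = m].
Proof.
rewrite {}/w; elim: k => [|k IH] Cm h.
  by split=> //=; rewrite ?addn0 //; split=> //; lia.
have [Cw e1 e2 e3 [e4 e5]] := IH Cm ltac:(lia).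
set w := iter k _ m in Cw e1 e2 e3 e4 e5.
have wR := C_supp Cw; have pos : (0 < eps R t w)%R by lia.
have [iR _ _ _ _] := erowP wR pos; rewrite iterS -/w.
split.
- by apply: C_e => //; lia.
- by rewrite /colsum psum_eop_t iR; rewrite /colsum in e1; lia.
- by have := psum_eop_t1 wR pos R; rewrite iR /colsum in e2 *; lia.
- by move=> x n1 n2; rewrite /colsum psum_eop //; apply: e3.
- by rewrite iterSr eopK // eps_eop // e4; split=> //; lia.
Qed.

Variables (n B : nat) (off v v' : nat -> nat).
Hypothesis C_box : forall m, C m -> boxed R n B m.
Hypotheses (tn : t.+1 < n) (offt : off t = off t.+1 + e0).
Hypotheses (v't : v' t = v t.+1) (v't1 : v' t.+1 = v t).
Hypothesis v'x : forall x, x != t -> x != t.+1 -> v' x = v x.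

Definition weighs (u : nat -> nat) (m : mat) :=
  forall x, x < n -> colsum R m x + off x = u x.

Lemma weighs_swap u u' m m' : colsum R m' t + off t = u' t ->
  colsum R m' t.+1 + off t.+1 = u' t.+1 ->
  (forall x, x != t -> x != t.+1 -> colsum R m' x = colsum R m x /\ u' x = u x) ->
  weighs u m -> weighs u' m'.
Proof.
move=> h1 h2 h3 hm x xn; case: (eqVneq x t) => [->//|n1].
by case: (eqVneq x t.+1) => [->//|n2]; have [-> ->] := h3 _ n1 n2; apply: hm.
Qed.

Lemma mcount_string_le : v t.+1 <= v t ->
  mcount R n B (fun m => C m /\ weighs v m) =
  mcount R n B (fun m => C m /\ weighs v' m).
Proof.
move=> le; pose k := v t - v t.+1; apply/anti_leq/andP; split.
  apply: (mcount_le (F := iter k (fop R t))) => [m _ [Cm hm]|m m' _ [Cm hm] _ [Cm' hm'] e].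
    have h1 := hm t (ltnW tn); have h2 := hm t.+1 tn; have ge := C_eps Cm.
    have [Cw e1 e2 e3 _] := @fop_iter k m Cm ltac:(lia).
    split; first exact: C_box.
    split=> //; apply: weighs_swap hm; [lia | lia | move=> x n1 n2].
    by split; [apply: e3 | apply: v'x].
  have h1 := hm t (ltnW tn); have h2 := hm t.+1 tn; have ge := C_eps Cm.
  have h1' := hm' t (ltnW tn); have h2' := hm' t.+1 tn; have ge' := C_eps Cm'.
  have [_ _ _ _ [_ <-]] := @fop_iter k m Cm ltac:(lia).
  by have [_ _ _ _ [_ <-]] := @fop_iter k m' Cm' ltac:(lia); rewrite e.
(* The height at R is the number of letters t+1 minus that of letters t, here exactly k + e0. *)
have ep m : C m -> weighs v' m -> ((k + e0)%:Z <= eps R t m)%R.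
  move=> Cm hm; have h1 := hm t (ltnW tn); have h2 := hm t.+1 tn.
  have := eps_max t (C_supp Cm) R; rewrite height_psum; last exact: C_supp.
  by rewrite -/(colsum R m t) -/(colsum R m t.+1); lia.
apply: (mcount_le (F := iter k (eop R t))) => [m _ [Cm hm]|m m' _ [Cm hm] _ [Cm' hm'] e].
  have h1 := hm t (ltnW tn); have h2 := hm t.+1 tn.
  have [Cw e1 e2 e3 _] := @eop_iter k m Cm (ep _ Cm hm).
  split; first exact: C_box.
  split=> //; apply: weighs_swap hm; [lia | lia | move=> x n1 n2].
  by split; [apply: e3 | rewrite v'x].
have [_ _ _ _ [_ <-]] := @eop_iter k m Cm (ep _ Cm hm).
by have [_ _ _ _ [_ <-]] := @eop_iter k m' Cm' (ep _ Cm' hm'); rewrite e.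
Qed.

End Strings.

Lemma mcount_string R t e0 C n B off v v' :
  (forall m, C m -> boxed R n B m) ->
  (forall m, C m -> (e0%:Z <= eps R t m)%R) ->
  (forall m, C m -> 0 < m (frow R t m) t -> C (fop R t m)) ->
  (forall m, C m -> (e0%:Z < eps R t m)%R -> C (eop R t m)) ->
  t.+1 < n -> off t = off t.+1 + e0 ->
  v' t = v t.+1 -> v' t.+1 = v t -> (forall x, x != t -> x != t.+1 -> v' x = v x) ->
  mcount R n B (fun m => C m /\ weighs R n off v m) =
  mcount R n B (fun m => C m /\ weighs R n off v' m).
Proof.
move=> Cb Ce Cf Cee tn ot h1 h2 h3; have Cs m : C m -> rowsupp R m by case/Cb.
case: (leqP (v t.+1) (v t)) => le; first exact: (mcount_string_le (t := t) (e0 := e0)).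
symmetry; apply: (mcount_string_le (t := t) (e0 := e0)) => //; first by move=> x ? ?; rewrite h3.
by rewrite h1 h2 ltnW.
Qed.

(** * Skew tableaux and lattice fillings *)

(* Row r of a tableau of shape lam/mu is recorded by the number m r x of its
   entries x, for x < n. *)
Record ssyt_mat (R n : nat) (mu rs : nat -> nat) (m : mat) : Prop := SsytMat {
  sm_supp : rowsupp R m;
  sm_col : forall r x, n <= x -> m r x = 0;
  sm_row : forall r, r < R -> psum (m r) n = rs r;
  sm_gt : gt_pattern mu m }.

(** It suffices to test the reading word just after the letters t+1 of each row, where the excess
    over the letters t is largest. *)
Definition lattice (R n : nat) (m : mat) := forall i t, i < R -> t.+1 < n ->
  (height m t i <= 0)%R.

(* Stembridge's involution: the first violating row i, and in it the largest
   violating letter t, are unchanged by the operators of index t, which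
   therefore reverse the t-strings of the class of (i, t). *)
Record first_viol (R n i t : nat) (m : mat) : Prop := FirstViol {
  fv_lt : t.+1 < n;
  fv_pos : (0 < height m t i)%R;
  fv_last : forall t', t < t' -> t'.+1 < n -> (height m t' i <= 0)%R;
  fv_first : forall i' t', i' < i -> t'.+1 < n -> (height m t' i' <= 0)%R }.

Lemma ssyt_mat_boxed R n B mu rs m : (forall r, rs r <= B) ->
  ssyt_mat R n mu rs m -> boxed R n B m.
Proof.
move=> rB [mR mn mr mg]; split=> // r x.
case: (leqP R r) => [/mR->//|rR]; case: (leqP n x) => [/mn->//|xn].
have := psum_gt (m r) (leq0n x) xn; rewrite psum0 mr //.
by move=> h; apply: leq_trans h (rB r).
Qed.

Lemma ssyt_mat_fop R n mu rs t m : t.+1 < n -> 0 < m (frow R t m) t ->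
  ssyt_mat R n mu rs m -> ssyt_mat R n mu rs (fop R t m).
Proof.
move=> tn md [mR mn mr mg]; split.
- exact: fop_supp.
- by move=> r x nx; rewrite fop_col ?mn //; lia.
- by move=> r rR; rewrite -(mr r rR) -(psum_fop_row md r n) (gtn_eqF tn) andbF addn0.
- exact: fop_gt.
Qed.

Lemma ssyt_mat_eop R n mu rs t m : t.+1 < n -> (0 < eps R t m)%R ->
  ssyt_mat R n mu rs m -> ssyt_mat R n mu rs (eop R t m).
Proof.
move=> tn mp [mR mn mr mg]; split.
- exact: eop_supp.
- by move=> r x nx; rewrite eop_col ?mn //; lia.
- by move=> r rR; rewrite -(mr r rR) (psum_eop_row mR mp) (gtn_eqF tn) andbF addn0.
- exact: eop_gt.
Qed.

Lemma first_viol_eps R n i t m : rowsupp R m -> first_viol R n i t m ->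
  (1 <= eps R t m)%R.
Proof. by move=> mR [_ pos _ _]; have := eps_max t mR i; lia. Qed.

(** The maximal height is positive while the heights above row i are not, so the raised letter lies
    in row i or lower; heights of the other indices can only fall. *)
Lemma first_viol_fop R n i t m : rowsupp R m -> 0 < m (frow R t m) t ->
  first_viol R n i t m -> first_viol R n i t (fop R t m).
Proof.
move=> mR md fv; have e1 := first_viol_eps mR fv; case: fv => tn pos la fi.
have ip : i <= frow R t m.
  by rewrite leqNgt; apply/negP => /fi/(_ tn); rewrite -/(eps R t m); lia.
have h r : (height (fop R t m) t r = height m t r + (frow R t m < r.+1)%:Z + (frow R t m < r)%:Z)%R.
  by rewrite /height psum_fop_t1; have := psum_fop_t md r; lia.
have h' t' r : t' != t -> (height (fop R t m) t' r <= height m t' r)%R.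
  move=> nt; rewrite /height; case: (eqVneq t' t.+1) => [->|n1].
    by rewrite psum_fop_t1 psum_fop; lia.
  case: (eqVneq t'.+1 t) => [e|n2]; last by rewrite !psum_fop //; lia.
  have -> : psum (col (fop R t m) t') r = psum (col m t') r by apply: psum_fop; lia.
  by rewrite e; have := psum_fop_t md r.+1; lia.
split=> //.
- by rewrite h; lia.
- by move=> t' tt' tn'; have := la t' tt' tn'; have := h' t' i; lia.
- move=> i' t' ii' tn'; have := fi i' t' ii' tn'.
  case: (eqVneq t' t) => [->|nt]; last by have := h' t' i' nt; lia.
  by rewrite h; lia.
Qed.

(** The bound 1 < eps keeps the height at i positive even if the letter is lowered in row i itself.
    Index t-1 may gain in row i, but there only indices above t are constrained. *)
Lemma first_viol_eop R n i t m : rowsupp R m -> (1 < eps R t m)%R ->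
  first_viol R n i t m -> first_viol R n i t (eop R t m).
Proof.
move=> mR m1 [tn pos la fi]; have mp : (0 < eps R t m)%R by lia.
have [iR _ he _ _] := erowP mR mp.
have ip : i <= erow R t m.
  by rewrite leqNgt; apply/negP => /fi/(_ tn); lia.
have h r : (height (eop R t m) t r + (erow R t m < r.+1)%:Z + (erow R t m < r)%:Z = height m t r)%R.
  by rewrite /height psum_eop_t; have := psum_eop_t1 mR mp r.+1; lia.
have h' t' r : r <= i -> t' != t -> (r < i) || (t < t') -> (height (eop R t m) t' r <= height m t' r)%R.
  move=> ri nt c; rewrite /height; case: (eqVneq t' t.+1) => [->|n1].
    have -> : psum (col (eop R t m) t.+2) r.+1 = psum (col m t.+2) r.+1 by apply: psum_eop; lia.
    by have := psum_eop_t1 mR mp r; lia.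
  case: (eqVneq t'.+1 t) => [e|n2]; last by rewrite !psum_eop //; lia.
  have -> : psum (col (eop R t m) t') r = psum (col m t') r by apply: psum_eop; lia.
  by rewrite e psum_eop_t; lia.
split=> //.
- have := h i; case: (eqVneq (erow R t m) i) => [e|ne]; last lia.
  by rewrite -{4}e he; lia.
- by move=> t' tt' tn'; have := la t' tt' tn'; have := h' t' i (leqnn i); lia.
- move=> i' t' ii' tn'; have := fi i' t' ii' tn'.
  case: (eqVneq t' t) => [->|nt]; last by have := h' t' i' (ltnW ii') nt; lia.
  by have := h i'; lia.
Qed.

Lemma first_viol_uniq R n i t i' t' m :
  first_viol R n i t m -> first_viol R n i' t' m -> i = i' /\ t = t'.
Proof.
move=> [tn p l f] [tn' p' l' f'].
have e : i = i'.
  by case: (ltngtP i i') => // h; [have := f' _ _ h tn | have := f _ _ h tn']; lia.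
rewrite -e in p' l'; split=> //.
by case: (ltngtP t t') => // h; [have := l _ h tn' | have := l' _ h tn]; lia.
Qed.

Lemma first_viol_exists R n m : ~ lattice R n m ->
  exists i t, i < R /\ first_viol R n i t m.
Proof.
move=> nl; apply: contrapT => no; apply: nl => i.
elim/ltn_ind: i => i IHi t iR tn.
have [d] := ubnP (n - t); elim: d t tn => // d IHt t tn hd.
case: (boolP (height m t i <= 0)%R) => // neg; case: no; exists i, t; split=> //.
split=> // [|t' tt' tn'|i' t' ii' tn']; first by lia.
  by apply: IHt => //; lia.
by apply: IHi => //; lia.
Qed.

Section Family.
Variables (R n B : nat) (mu rs : nat -> nat).
Hypothesis rsB : forall r, rs r <= B.
Implicit Types (a kappa : {ffun 'I_n -> nat}).

Definition has_wt (m : mat) a := forall k : 'I_n, colsum R m k = a k.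

Definition skew_chr a : rat :=
  ((mcount R n B (fun m => ssyt_mat R n mu rs m /\ has_wt m a))%:R)%R.

Definition hw_count kappa : nat :=
  mcount R n B (fun m => [/\ ssyt_mat R n mu rs m, lattice R n m & has_wt m kappa]).

Let X := [set d : code R n B | `[< ssyt_mat R n mu rs (decode d) >]].
Let wt (d : code R n B) : {ffun 'I_n -> nat} := [ffun k : 'I_n => colsum R (decode d) k].
Let cls (d : code R n B) : option ('I_R * 'I_n) :=
  [pick p : 'I_R * 'I_n | `[< first_viol R n p.1 p.2 (decode d) >]].
Let nfun a (x : nat) : nat := if insub x is Some k then a k else 0.

Let nfunE a (k : 'I_n) : nfun a k = a k.
Proof. by rewrite /nfun valK. Qed.

Let nfun_tperm a (j j' : 'I_n) : j' = j.+1 :> nat ->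
  [/\ nfun (pact a (tperm j j')) j = nfun a j.+1,
      nfun (pact a (tperm j j')) j.+1 = nfun a j &
      forall x : nat, x != j -> x != j.+1 -> nfun (pact a (tperm j j')) x = nfun a x].
Proof.
move=> e; rewrite -e !nfunE !ffunE tpermL tpermR; split=> // x n1 n2.
rewrite /nfun; case: insubP => // k _ kx; rewrite ffunE tpermD //.
  by apply: contraNneq n1 => ->; rewrite kx.
by apply: contraNneq n2 => ->; rewrite kx.
Qed.

Let wtP d a : reflect (has_wt (decode d) a) (wt d == a).
Proof.
apply: (iffP eqP) => [<- k|h]; first by rewrite ffunE.
by apply/ffunP => k; rewrite ffunE h.
Qed.

Let chrE a : character X wt a = skew_chr a.
Proof.
rewrite /character /skew_chr /mcount; congr (_%:R)%R; apply: eq_card => d.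
by rewrite !inE; apply/andP/asboolP => [[/asboolP h /wtP]|[h /wtP->]]; rewrite ?asboolT.
Qed.

Lemma skew_chr_sym : adj_sym skew_chr.
Proof.
move=> j j' e a; rewrite /skew_chr; congr (_%:R)%R.
have [h1 h2 h3] := nfun_tperm a e.
have aux b : mcount R n B (fun m => ssyt_mat R n mu rs m /\ has_wt m b) =
    mcount R n B (fun m => ssyt_mat R n mu rs m /\ weighs R n (fun _ => 0) (nfun b) m).
  apply: eq_card => d; rewrite !inE; apply/asboolP/asboolP => -[h hw]; split=> //.
    by move=> x xn; rewrite addn0 (hw (Ordinal xn)) -nfunE.
  by move=> k; have := hw k (ltn_ord k); rewrite addn0 nfunE.
rewrite !aux; symmetry; apply: (mcount_string (t := j) (e0 := 0)) => //.
- by move=> m; apply: ssyt_mat_boxed.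
- by move=> m [mR _ _ _]; apply: eps_ge0.
- by move=> m sm md; apply: ssyt_mat_fop => //; rewrite -e.
- by move=> m sm md; apply: ssyt_mat_eop => //; rewrite -e.
- by rewrite -e.
Qed.

Let clsP d (p : 'I_R * 'I_n) : reflect (first_viol R n p.1 p.2 (decode d)) (cls d == Some p).
Proof.
rewrite /cls; apply: (iffP eqP); case: pickP => [q /asboolP fq|no //].
- by case=> <-.
- move=> fp; congr Some; have [e1 e2] := first_viol_uniq fq fp.
  by case: q p e1 e2 {fq fp} => [q1 q2] [p1 p2] /= /val_inj-> /val_inj->.
- by move/asboolP; rewrite no.
Qed.

Let clsN d : reflect (lattice R n (decode d)) (cls d == None).
Proof.
rewrite /cls; apply: (iffP eqP); case: pickP => [q /asboolP fq|no] //.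
  move=> _; apply: contrapT => /first_viol_exists[i [t [iR fv]]].
  have tn := ltnW (fv_lt fv).
  by move: (no (Ordinal iR, Ordinal tn)); rewrite /= asboolT.
move=> lat; case: fq => tn pos _ _; have := lat _ _ (ltn_ord q.1) tn.
by move: pos => /=; lia.
Qed.

Lemma lattice_dominant m a : ssyt_mat R n mu rs m -> lattice R n m ->
  has_wt m a -> dominant a.
Proof.
move=> [mR _ _ _] lat hw j j' e; rewrite -!hw /colsum e.
have tn : j.+1 < n by rewrite -e.
case: R lat mR => [|R'] lat mR; first by rewrite !psum0.
have := lat R' j (ltnSn _) tn; rewrite /height.
by have := leq_psum (col m j) (leqnSn R'); lia.
Qed.

Lemma alternant_skew kappa : dominant kappa ->
  alternant skew_chr kappa = ((hw_count kappa)%:R)%R.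
Proof.
move=> dk; have -> : skew_chr = character X wt by apply/funext => a; rewrite chrE.
rewrite (alternant_character (cls := cls)) //.
- congr (_%:R)%R; apply: eq_card => d; rewrite !inE.
  apply/andP/asboolP => [[/asboolP h /andP[/clsN h1 /wtP h2]]|[h h1 h2]]; first by [].
  by split; [apply/asboolP | apply/andP; split; [apply/clsN | apply/wtP]].
- by move=> j j' e a; rewrite !chrE; apply: skew_chr_sym.
- move=> [i t] [d0 _ /eqP/clsP/= fv0]; have tn := fv_lt fv0.
  pose t' := Ordinal tn; exists t, t'; split=> // v.
  pose C m := ssyt_mat R n mu rs m /\ first_viol R n i t m.
  have [h1 h2 h3] := nfun_tperm v (erefl : t' = t.+1 :> nat).
  have aux u : #|[set x in X | (cls x == Some (i, t)) && (shift (wt x) == u)]| =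
      mcount R n B (fun m => C m /\ weighs R n (fun x => n - x.+1) (nfun u) m).
    apply: eq_card => d; rewrite !inE; apply/andP/asboolP.
      move=> [/asboolP h /andP[/clsP/= h' /eqP/ffunP hu]]; split=> // x xn.
      by have := hu (Ordinal xn); rewrite !ffunE -nfunE.
    move=> [[h h'] hu]; split; [exact/asboolP | apply/andP; split; first exact/clsP].
    by apply/eqP/ffunP => k; rewrite !ffunE -nfunE -hu.
  rewrite !aux; symmetry; apply: (mcount_string (t := t) (e0 := 1)) => //.
  + by move=> m [h _]; apply: ssyt_mat_boxed h.
  + by move=> m [[mR _ _ _] fv]; have := first_viol_eps mR fv; lia.
  + move=> m [h fv] md; split; first exact: ssyt_mat_fop.
    by case: h => mR _ _ _; apply: first_viol_fop.
  + move=> m [h fv] md; split; first by apply: ssyt_mat_eop => //; lia.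
    by case: h => mR _ _ _; apply: first_viol_eop.
  + by move=> /=; lia.
- move=> d; rewrite inE => /asboolP h /eqP/clsN lat.
  by apply: (lattice_dominant h lat); apply/wtP.
Qed.

End Family.

Lemma nth_leq_sumn (s : seq nat) i : nth 0 s i <= sumn s.
Proof.
elim: s i => [|x s IH] [|i] //=; first by rewrite leq_addr.
by apply: leq_trans (IH i) _; rewrite leq_addl.
Qed.

Lemma psum_nth (s : seq nat) R : size s <= R -> psum (nth 0 s) R = sumn s.
Proof.
move=> sR; rewrite sumnE (big_nth 0) big_mkord -/(psum (nth 0 s) (size s)).
by apply: psum_stable => // k hk; rewrite nth_default.
Qed.

Lemma nth_partition nu i : is_partition nu -> nth 0 nu i.+1 <= nth 0 nu i.
Proof.
case/andP=> so _; case: (ltnP i.+1 (size nu)) => h; last by rewrite nth_default.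
exact: (elimT (sortedP 0) so i h).
Qed.

Lemma psum_single i c x : psum (fun y => if y == i then c else 0) x = if i < x then c else 0.
Proof.
elim: x => [|x IH]; first by rewrite psum0.
by rewrite psumS IH ltnS; case: (ltngtP i x) => h //=; rewrite ?addn0.
Qed.

(** A letter t+1 in row i needs a letter t in an earlier row, which by induction holds no letter
    beyond its own index. *)
Lemma lattice_up R n m : rowsupp R m -> (forall r x, n <= x -> m r x = 0) ->
  lattice R n m -> forall i x, i < x -> m i x = 0.
Proof.
move=> mR mn lat; elim/ltn_ind=> i IH [//|t]; rewrite ltnS => it.
case: (leqP R i) => [/mR->//|iR]; case: (leqP n t.+1) => [/mn->//|tn].
have := lat i t iR tn; rewrite /height psumS (psum_eq0 (a := col m t)) ?colE; first by lia.
by move=> k ki; apply: IH => //; apply: leq_trans it.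
Qed.

(** * Schur positivity by highest weights *)

Section Straight.
Variables (n : nat) (nu : seq nat).
Hypotheses (nuP : is_partition nu) (nun : size nu <= n).

Definition pad : {ffun 'I_n -> nat} := [ffun k : 'I_n => nth 0 nu k].

Definition diag_mat : mat := fun r x => if x == r then nth 0 nu r else 0.

Lemma diag_mat_psum r x : psum (diag_mat r) x = if r < x then nth 0 nu r else 0.
Proof. exact: psum_single. Qed.

Lemma diag_mat_col x r : psum (col diag_mat x) r = if x < r then nth 0 nu x else 0.
Proof.
rewrite -psum_single; apply: eq_psum => k _.
by rewrite colE /diag_mat eq_sym; case: eqP => // ->.
Qed.

Lemma diag_ssyt_mat : ssyt_mat (size nu) n (fun _ => 0) (nth 0 nu) diag_mat.
Proof.
split.
- by move=> r x h; rewrite /diag_mat nth_default ?if_same.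
- move=> r x h; rewrite /diag_mat; case: eqP => // e.
  by rewrite nth_default // -e; apply: leq_trans h.
- by move=> r h; rewrite diag_mat_psum (leq_trans h).
- move=> i x; rewrite !diag_mat_psum ltnS; case: ifP => //.
  by rewrite !add0n nth_partition.
Qed.

Lemma diag_lattice : lattice (size nu) n diag_mat.
Proof.
move=> i t _ _; rewrite /height !diag_mat_col ltnS; case: ifP => // _.
by have := nth_partition t nuP; lia.
Qed.

(** The lattice condition bounds the letters of row i by i from above, column strictness from
    below. *)
Lemma lattice_ssyt_diag m : ssyt_mat (size nu) n (fun _ => 0) (nth 0 nu) m ->
  lattice (size nu) n m -> m = diag_mat.
Proof.
move=> [mR mn mr mg] lat.
have up := lattice_up mR mn lat.
have lo i : psum (m i) i = 0.
  elim: i => [|i IH]; first by rewrite psum0.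
  by have := mg i i; rewrite IH; lia.
apply/funext => i; apply/funext => x; rewrite /diag_mat.
case: (ltngtP x i) => h; last 1 first.
- case: (leqP (size nu) i) => iR; first by rewrite h mR // nth_default.
  have iN := leq_trans iR nun; rewrite h -(mr i iR).
  rewrite (psum_stable (R := i.+1)) //; first by rewrite psumS lo.
  by move=> k; apply: up.
- by have := psum_gt (m i) (leq0n x) h; rewrite lo; lia.
- by rewrite up.
Qed.

Lemma hw_straight B kappa : sumn nu <= B ->
  hw_count (size nu) B (fun _ => 0) (nth 0 nu) kappa = (kappa == pad) :> nat.
Proof.
move=> nB; have dB : boxed (size nu) n B diag_mat.
  apply: ssyt_mat_boxed diag_ssyt_mat => r.
  by apply: leq_trans (nth_leq_sumn _ _) nB.
have wd : has_wt (size nu) diag_mat pad.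
  move=> k; rewrite /colsum diag_mat_col ffunE; case: ltnP => // h.
  by rewrite nth_default.
rewrite /hw_count /mcount; case: eqP => [->|ne].
  apply/eqP/cards1P; exists (encode (size nu) n B diag_mat).
  apply/setP => d; rewrite !inE; apply/asboolP/eqP => [[h1 h2 _]|->].
    by rewrite -(lattice_ssyt_diag h1 h2) decodeK.
  by rewrite encodeK //; split; [exact: diag_ssyt_mat | exact: diag_lattice |].
apply/eqP; rewrite cards_eq0; apply/eqP/setP => d; rewrite !inE; apply/asboolP.
move=> [h1 h2 h3]; apply: ne; apply/ffunP => k.
by rewrite -h3 (lattice_ssyt_diag h1 h2) wd.
Qed.

Lemma pad_dominant : dominant pad.
Proof. by move=> j j' e; rewrite !ffunE e nth_partition. Qed.

End Straight.

Lemma pad_inj n nu nu' : is_partition nu -> is_partition nu' ->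
  size nu <= n -> size nu' <= n -> pad n nu = pad n nu' -> nu = nu'.
Proof.
have le a b : is_partition a -> size a <= n -> pad n a = pad n b -> size a <= size b.
  case/andP=> _ /allP pos an /ffunP e; rewrite leqNgt; apply/negP => h.
  have := e (Ordinal (leq_trans h an)); rewrite !ffunE /= [RHS]nth_default //.
  by move=> e0; have := pos _ (mem_nth 0 h); rewrite e0.
move=> p p' s s' e; have es : size nu = size nu' by apply/anti_leq; rewrite !le.
apply: (@eq_from_nth _ 0) => // i hi.
by move/ffunP/(_ (Ordinal (leq_trans hi s))): e; rewrite !ffunE.
Qed.

Definition positives (l : seq nat) := [seq x <- l | 0 < x].

Lemma positives_nth l i : sorted geq l -> nth 0 (positives l) i = nth 0 l i.
Proof.
elim: l i => //= x l IH i pl; have sl := path_sorted pl.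
case: (posnP x) => [x0|x0]; last by case: i => //= i; apply: IH.
have z y : y \in l -> y = 0.
  have tr : transitive geq by move=> b a c /= ab bc; apply: leq_trans bc ab.
  by move/(allP (order_path_min tr pl)); rewrite x0 /=; lia.
rewrite /positives (eq_in_filter (a2 := pred0)); last by move=> y /z->.
rewrite filter_pred0 nth_nil; case: i => [|i]; first by rewrite x0.
case: (ltnP i (size l)) => h; last by rewrite /= nth_default.
by rewrite /= (z _ (mem_nth 0 h)).
Qed.

Lemma positives_partition l : sorted geq l -> is_partition (positives l).
Proof.
move=> sl; rewrite /is_partition filter_all andbT sorted_filter //.
by move=> y x z /= xy yz; apply: leq_trans yz xy.
Qed.

(** The explicit list makes the set of candidate partitions finite, as the expansion into Schur
    polynomials requires. *)
Lemma dominant_pad n N (kappa : {ffun 'I_n -> nat}) : dominant kappa ->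
  weight_sum kappa = N -> exists nu, [/\ is_partition nu, size nu <= n, sumn nu = N,
    pad n nu = kappa &
    nu \in [seq positives (map val (val t)) | t : n.-tuple 'I_N.+1]].
Proof.
move=> dk sk; have kN k : kappa k <= N by rewrite -sk /weight_sum (bigD1 k) //= leq_addr.
pose t : n.-tuple 'I_N.+1 := [tuple inord (kappa k) | k < n].
pose l := map val (val t).
have el : l = map kappa (enum 'I_n).
  rewrite /l /= -map_comp; apply: eq_map => k /=.
  by rewrite inordK // ltnS.
have sl : size l = n by rewrite el size_map size_enum_ord.
have nl (k : 'I_n) : nth 0 l k = kappa k by rewrite el (nth_map k) ?size_enum_ord // nth_ord_enum.
have so : sorted geq l.
  apply/(sortedP 0) => i; rewrite sl => h.
  by rewrite -[i]/(val (Ordinal (ltnW h))) -[i.+1]/(val (Ordinal h)) !nl /=; apply: dk.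
have sp : size (positives l) <= n by rewrite -sl size_filter count_size.
exists (positives l); split=> //.
- exact: positives_partition.
- rewrite -(psum_nth (R := n)) // -sk /weight_sum /psum; apply: eq_bigr => k _.
  by rewrite positives_nth // nl.
- by apply/ffunP => k; rewrite ffunE positives_nth // nl.
- by apply/codomP; exists t.
Qed.

Definition straight_chr n nu : {ffun 'I_n -> nat} -> rat :=
  skew_chr (size nu) (sumn nu) (fun _ => 0) (nth 0 nu).

Lemma weight_sum_mat R n mu rs m (a : {ffun 'I_n -> nat}) :
  ssyt_mat R n mu rs m -> has_wt R m a -> weight_sum a = psum rs R.
Proof.
move=> [_ _ mr _] hw; rewrite /weight_sum; under eq_bigr do rewrite -hw.
rewrite /colsum /psum exchange_big /=; apply: eq_bigr => r _.
by rewrite -mr.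
Qed.

Lemma mcount_exists R n B P : mcount R n B P != 0 -> exists m, P m.
Proof.
rewrite /mcount cards_eq0 => /set0Pn[d]; rewrite inE => /asboolP h.
by exists (decode d).
Qed.

Section Expansion.
Import GRing.Theory Num.Theory.
Variables (n N R R' B B' : nat) (mu mu' rs rs' : nat -> nat).
Hypotheses (rsB : forall r, rs r <= B) (rsB' : forall r, rs' r <= B').

Let chi (a : {ffun 'I_n -> nat}) : rat := (skew_chr R B mu rs a - skew_chr R' B' mu' rs' a)%R.
Let hw (kappa : {ffun 'I_n -> nat}) := hw_count R B mu rs kappa.
Let hw' (kappa : {ffun 'I_n -> nat}) := hw_count R' B' mu' rs' kappa.

Let alternant_chi kappa : dominant kappa ->
  alternant chi kappa = ((hw kappa)%:R - (hw' kappa)%:R)%R.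
Proof.
move=> dk; rewrite -(alternant_skew _ _ rsB) // -(alternant_skew _ _ rsB') //.
have := alternant_sum [:: true; false] (fun b => if b then 1 else -1)%R
  (fun b => if b then skew_chr R B mu rs else skew_chr R' B' mu' rs') kappa.
rewrite !big_cons big_nil mul1r mulN1r addr0 => <-; congr alternant.
by apply/funext => a; rewrite !big_cons big_nil mul1r mulN1r addr0.
Qed.

(** Alternants are linear and turn each Schur polynomial into a count of lattice fillings, hence
    into something non-negative. *)
Lemma hw_le_of_schur_pos (s : seq (seq nat)) (c : seq nat -> rat) :
  (forall nu, 0 <= c nu)%R ->
  (forall a, chi a = \sum_(nu <- s) c nu * straight_chr nu a)%R ->
  forall kappa, dominant kappa -> hw' kappa <= hw kappa.
Proof.
move=> c0 e kappa dk; rewrite -(ler_nat rat) -subr_ge0 -alternant_chi //.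
have -> : chi = (fun a => \sum_(nu <- s) c nu * straight_chr nu a)%R by apply/funext.
rewrite alternant_sum; apply: sumr_ge0 => nu _; apply: mulr_ge0 => //.
by rewrite alternant_skew ?ler0n // => r; apply: nth_leq_sumn.
Qed.

Hypotheses (rsN : psum rs R = N) (rsN' : psum rs' R' = N).
Hypothesis hw_le : forall kappa, hw' kappa <= hw kappa.

(** The coefficient at nu is the difference of the counts of lattice fillings. By [hw_straight] the
    two sides then have equal alternants, and [alternant_uniq] identifies them. *)
Lemma schur_pos_of_hw_le : exists (s : seq (seq nat)) (c : seq nat -> rat),
  [/\ all is_partition s, (forall nu, 0 <= c nu)%R &
      forall a, chi a = \sum_(nu <- s) c nu * straight_chr nu a]%R.
Proof.
pose s := [seq nu <- undup [seq positives (map val (val t)) | t : n.-tuple 'I_N.+1] |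
  [&& is_partition nu, size nu <= n & sumn nu == N]].
pose c nu : rat := ((hw (pad n nu))%:R - (hw' (pad n nu))%:R)%R.
have sP nu : nu \in s -> [/\ is_partition nu, size nu <= n & sumn nu = N].
  by rewrite mem_filter => /andP[/and3P[h1 h2 /eqP h3] _].
have us : uniq s by rewrite filter_uniq // undup_uniq.
exists s, c; split.
- by apply/allP => nu /sP[].
- by move=> nu; rewrite subr_ge0 ler_nat.
pose psi (a : {ffun 'I_n -> nat}) : rat := (\sum_(nu <- s) c nu * straight_chr nu a)%R.
suff h a : (chi a - psi a = 0)%R by move=> a; apply/eqP; rewrite -subr_eq0 h.
have psi_sym : adj_sym psi.
  move=> j j' e b; apply: eq_bigr => nu _; congr (_ * _)%R.
  by apply: skew_chr_sym => // r; apply: nth_leq_sumn.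
move: a; apply: (@alternant_uniq n (fun a => chi a - psi a)%R N) => [j j' e a|a|kappa dk].
- by rewrite psi_sym // /chi !skew_chr_sym.
- apply: contraNeq => aN; rewrite /chi /psi.
  have z R0 B0 mu0 rs0 : psum rs0 R0 = N -> skew_chr R0 B0 mu0 rs0 a = 0%R.
    move=> e; rewrite /skew_chr; apply/eqP; rewrite pnatr_eq0; apply/negPn/negP.
    by case/mcount_exists=> m [h1 h2]; case/eqP: aN; rewrite (weight_sum_mat h1 h2).
  rewrite !z // big_seq big1 ?subr0 // => nu /sP[h1 h2 h3].
  by rewrite /straight_chr z ?mulr0 // psum_nth.
- have -> : alternant (fun a => chi a - psi a)%R kappa = (alternant chi kappa - alternant psi kappa)%R.
    have := alternant_sum [:: true; false] (fun b => if b then 1 else -1)%R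
      (fun b => if b then chi else psi) kappa.
    rewrite !big_cons big_nil mul1r mulN1r addr0 => <-; congr alternant.
    by apply/funext => a; rewrite !big_cons big_nil mul1r mulN1r addr0.
  rewrite alternant_chi // alternant_sum.
  have -> : (\sum_(nu <- s) c nu * alternant (straight_chr nu) kappa =
             \sum_(nu <- s) c nu * (kappa == pad n nu)%:R)%R.
    rewrite big_seq [RHS]big_seq; apply: eq_bigr => nu /sP[h1 h2 h3]; congr (_ * _)%R.
    rewrite alternant_skew //; last by move=> r; apply: nth_leq_sumn.
    by rewrite hw_straight.
  case: (pselect (exists2 nu, nu \in s & pad n nu = kappa)) => [[nu nus e]|no].
    rewrite (bigD1_seq nu) //= e eqxx mulr1 /c e big_seq_cond big1 ?addr0 ?subrr //.
    move=> nu' /andP[/sP[h1 h2 _] ne]; have [h1' h2' _] := sP _ nus.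
    case: eqP => [e'|_]; last by rewrite mulr0.
    by case/eqP: ne; apply: (pad_inj (n := n)) => //; rewrite -e'.
  rewrite [X in (_ - X)%R]big_seq big1 => [|nu nus]; last first.
    by case: eqP => [e|_]; rewrite ?mulr0 //; case: no; exists nu.
  suff z R0 B0 mu0 rs0 : psum rs0 R0 = N -> hw_count R0 B0 mu0 rs0 kappa = 0.
    by rewrite /hw /hw' !z // !subr0.
  move=> e; apply/eqP/negPn/negP => /mcount_exists[m [h1 _ h2]].
  have [nu [p1 p2 p3 p4 p5]] := dominant_pad dk (etrans (weight_sum_mat h1 h2) e).
  by apply: no; exists nu => //; rewrite mem_filter p1 p2 p3 eqxx mem_undup.
Qed.

End Expansion.

Lemma ltn_psum a b R j : (forall k, a k <= b k) -> j < R -> a j < b j ->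
  psum a R < psum b R.
Proof.
move=> le jR lt; have leS p : psum a p <= psum b p by apply: leq_sum.
elim: R jR => // R IH; rewrite ltnS leq_eqVlt !psumS => /orP[/eqP e|/IH].
  by have := leS R; rewrite -e; lia.
by have := le R; lia.
Qed.

(** * Monotonicity in the dominance order *)

Section RibbonTableaux.
Variables (L n B : nat) (kappa : nat -> nat).
Hypothesis kappaB : forall x, kappa x <= B.

(* The tableau of shape kappa and content alpha attached to a lattice filling
   of the ribbon alpha: q x k is the number of letters x in row k of the ribbon. *)
Record ribbon_tab (alpha : nat -> nat) (q : mat) : Prop := RibbonTab {
  rt_supp : rowsupp n q;
  rt_col : forall x k, L <= k -> q x k = 0;
  rt_row : forall x, x < n -> psum (q x) L = kappa x;
  rt_gt : gt_pattern (fun _ => 0) q;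
  rt_cont : forall k, k < L -> psum (col q k) n = alpha k;
  rt_pair : forall k, k.+1 < L -> pair q k }.

Definition tab_count alpha := mcount n L B (ribbon_tab alpha).

Lemma ribbon_tab_boxed alpha q : ribbon_tab alpha q -> boxed n L B q.
Proof.
move=> [qR qc qr _ _ _]; split=> // x k.
case: (leqP n x) => [/qR->//|xn]; case: (leqP L k) => [/qc->//|kL].
have := psum_gt (q x) (leq0n k) kL; rewrite psum0 qr //.
by move=> h; apply: leq_trans h (kappaB x).
Qed.

Lemma eq_tab_count alpha beta : (forall k, k < L -> alpha k = beta k) ->
  tab_count alpha = tab_count beta.
Proof.
move=> e; apply: eq_card => d; rewrite !inE; apply/asboolP/asboolP.
  by case=> h1 h2 h3 h4 h5 h6; split=> // k kL; rewrite -e // h5.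
by case=> h1 h2 h3 h4 h5 h6; split=> // k kL; rewrite e // h5.
Qed.

Record shape_tab (q : mat) : Prop := ShapeTab {
  st_col : forall x k, L <= k -> q x k = 0;
  st_row : forall x, x < n -> psum (q x) L = kappa x;
  st_gt : gt_pattern (fun _ => 0) q }.

Lemma shape_tab_fop k q : k.+1 < L -> rowsupp n q -> 0 < q (frow n k q) k ->
  shape_tab q -> shape_tab (fop n k q).
Proof.
move=> kL qR qd [qc qr qg]; split.
- by move=> x j hj; rewrite fop_col ?qc //; lia.
- by move=> x xn; rewrite -(qr x xn) -(psum_fop_row qd x L) (gtn_eqF kL) andbF addn0.
- exact: fop_gt.
Qed.

Definition move (i j : nat) (alpha : nat -> nat) (k : nat) := alpha k - (k == i) + (k == j).

Lemma psum_move i j alpha p : 0 < alpha i ->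
  psum (move i j alpha) p + (i < p) = psum alpha p + (j < p).
Proof.
move=> ai; rewrite -!psum_delta -!psum_add; apply: eq_psum => k _.
by rewrite /move; case: (eqVneq k i) => [->|_] /=; lia.
Qed.

Lemma tab_count_adjacent alpha i : i.+1 < L -> alpha i.+1 + 2 <= alpha i ->
  tab_count alpha <= tab_count (move i i.+1 alpha).
Proof.
move=> iL ai.
have df q : ribbon_tab alpha q -> 0 < q (frow n i q) i.
  case=> qR _ _ _ qa _; apply: f_defined_gt => //.
  by rewrite !qa //; lia.
apply: (mcount_le (F := fop n i)); last first.
  move=> q q' _ hq _ hq' e.
  by rewrite -(fopK (rt_supp hq) (df _ hq)) e (fopK (rt_supp hq') (df _ hq')).
move=> q _ hq; have qd := df q hq; case: hq => qR qc qr qg qa qp.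
have kl : keeps_last n i q by apply: keeps_last_two => //; rewrite !qa //; lia.
have [rR _ _] := frowP qR qd.
have [c' r' g'] := shape_tab_fop iL qR qd (ShapeTab qc qr qg).
have hq : ribbon_tab (move i i.+1 alpha) (fop n i q).
  split=> //; first exact: fop_supp.
    move=> k kL; rewrite /move -qa //; case: (eqVneq k i) => [->|n1].
      by have := psum_fop_t qd n; rewrite rR; lia.
    case: (eqVneq k i.+1) => [->|n2]; first by rewrite psum_fop_t1 rR; lia.
    by rewrite psum_fop //; lia.
  move=> k kL; have pk := qp k kL; case: (eqVneq k i) => [e|n1].
    by rewrite e in pk *; apply/pair_fop.
  case: (eqVneq k i.+1) => [e|n2]; first by rewrite e in pk *; apply: pair_fop_up.
  case: (eqVneq k.+1 i) => [e|n3]; last by apply: pair_fop_other.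
  by rewrite -e in kl *; apply: pair_fop_keep.
by split=> //; apply: ribbon_tab_boxed hq.
Qed.

Lemma tab_count_block alpha lo hi c : 1 < c -> lo < hi -> hi < L ->
  (forall k, lo <= k <= hi -> alpha k + (k == hi) = c + (k == lo)) ->
  tab_count alpha <= tab_count (move lo hi alpha).
Proof.
move=> c1 lh hL ha; pose D y := y.+1 < L.
have Db y : lo <= y < hi -> D y by rewrite /D; lia.
have bs q : ribbon_tab alpha q -> bstate n D lo hi c hi q.
  case=> qR _ _ _ qa qp; split=> // [y hy|]; last by rewrite ltnn.
  by rewrite qa ?ha //; lia.
apply: (mcount_le (F := bmap n lo (hi - lo) hi)); last first.
  move=> q q' _ hq _ hq'; apply: (bmap_inj c1 Db) => //; [lia | exact: bs | exact: bs].
move=> q _ hq; have [S cl _] := bmap_spec c1 Db (ltac:(lia) : lo <= hi <= hi) (leqnn _) (bs q hq).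
case: hq => qR qc qr qg qa qp.
(* The closure clause of [bmap_spec] carries what [bstate] does not record: the shape, and the
   content outside the block. *)
have [[c' r' g'] out] : shape_tab (bmap n lo (hi - lo) hi q) /\
    forall k, k < L -> ~~ (lo <= k <= hi) -> psum (col (bmap n lo (hi - lo) hi q) k) n = alpha k.
  apply: (cl (fun q => shape_tab q /\
    forall k, k < L -> ~~ (lo <= k <= hi) -> psum (col q k) n = alpha k)); last first.
    by split=> // k kL _; apply: qa.
  move=> x w hx wR wd [sw ow]; split; first by apply: shape_tab_fop => //; lia.
  by move=> k kL hk; rewrite psum_fop ?ow //; lia.
have hq : ribbon_tab (move lo hi alpha) (bmap n lo (hi - lo) hi q).
  case: S => sR sp sc _; split=> // k kL; rewrite /move.
  case: (boolP (lo <= k <= hi)) => hk; last by rewrite out //; lia.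
  by have := sc k hk; have := ha k hk; lia.
by split=> //; apply: ribbon_tab_boxed hq.
Qed.

Lemma nonincr_le (a : nat -> nat) : (forall k, k.+1 < L -> a k.+1 <= a k) ->
  forall k l, k <= l -> l < L -> a l <= a k.
Proof.
move=> dec k l; elim: l => [|l IH]; first by rewrite leqn0 => /eqP->.
rewrite leq_eqVlt => /orP[/eqP->//|]; rewrite ltnS => kl lL.
by apply: leq_trans (dec _ lL) (IH kl (ltnW lL)).
Qed.

(** Induction on the sum of the partial sums of lam, which every move lowers. From the first
    difference i0 up to the first later j with lam j <= lam i0 - 2, the partial sums of lam stay
    strictly above those of mu, so a box may go from some i in between to j. *)
Lemma tab_count_dom (mu lam : nat -> nat) :
  (forall k, k.+1 < L -> mu k.+1 <= mu k) ->
  (forall k, k.+1 < L -> lam k.+1 <= lam k) ->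
  (forall k, k < L -> 0 < lam k) ->
  (forall p, p <= L -> psum mu p <= psum lam p) -> psum mu L = psum lam L ->
  tab_count lam <= tab_count mu.
Proof.
move=> mudec; have [d] := ubnP (psum (fun p => psum lam p) L.+1).
elim: d lam => // d IH lam hd ldec lpos dom eqL; have mule := nonincr_le mudec.
case: (pselect (forall k, k < L -> lam k = mu k)) => [e|].
  by rewrite (eq_tab_count e).
move=> /existsNP[k1 /not_implyP[k1L /eqP ne1]].
have exi : exists k, (k < L) && (lam k != mu k) by exists k1; rewrite k1L.
case: (ex_minnP exi) => i0 /andP[i0L ne0] min0.
have eq0 : psum lam i0 = psum mu i0.
  apply: eq_psum => k ki; apply/eqP/negPn/negP => nk.
  by have := min0 k; rewrite nk andbT; lia.
have lt0 : mu i0 < lam i0.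
  by have := dom i0.+1 i0L; rewrite !psumS eq0; move/eqP: ne0; lia.
(* The gap opened at i0 persists, since mu k <= mu i0 < lam i0 <= lam k + 1. *)
have strict p : i0 < p -> p <= L -> (forall k, i0 < k -> k < p -> lam i0 <= (lam k).+1) ->
    psum mu p < psum lam p.
  elim: p => // p IHp; rewrite ltnS leq_eqVlt => /orP[/eqP<-|ip] pL h.
    by rewrite !psumS eq0; lia.
  have := IHp ip (ltnW pL) (fun k h1 h2 => h k h1 (ltnW h2)).
  by have := h p ip (ltnSn p); have := mule i0 p (ltnW ip) pL; rewrite !psumS; lia.
(* Without such a j the strict inequality would reach L, against the equal totals. *)
have exj : exists j, [&& i0 < j, j < L & (lam j).+1 < lam i0].
  apply: contrapT => no; have := strict L i0L (leqnn L); rewrite eqL ltnn => F.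
  suff: false by []; apply: F.
  move=> k ik kL; rewrite leqNgt; apply/negP => h.
  by apply: no; exists k; rewrite ik kL.
case: (ex_minnP exj) => j /and3P[ij jL lj] minj.
have geq k : i0 < k -> k < j -> lam i0 <= (lam k).+1.
  move=> ik kj; rewrite leqNgt; apply/negP => h.
  by have := minj k; rewrite ik h (ltn_trans kj jL) => /(_ isT); lia.
have sj p : i0 < p -> p <= j -> psum mu p < psum lam p.
  move=> ip pj; apply: strict => //; first by lia.
  by move=> k h1 h2; apply: geq => //; lia.
have lamle := nonincr_le ldec.
suff [i [ii ij' decij le_move]] : exists i, [/\ i0 <= i, i < j,
    forall k, k.+1 < L -> move i j lam k.+1 <= move i j lam k &
    tab_count lam <= tab_count (move i j lam)].
  have li := lpos i (ltn_trans ij' jL).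
  apply: leq_trans le_move (IH _ _ decij _ _ _).
  - rewrite ltnS in hd; apply: (leq_trans _ hd).
    have le p : psum (move i j lam) p <= psum lam p.
      by have := psum_move j p li; case: ltnP; case: ltnP; lia.
    apply: (ltn_psum le (j := j)); first by rewrite ltnS ltnW.
    by have := psum_move j j li; rewrite ij' ltnn; lia.
  - move=> k kL; rewrite /move; have := lpos k kL; case: (eqVneq k i) => [e|_] /=; last by lia.
    have := lamle i0 i ii ltac:(lia); have := lamle i j (ltnW ij') jL.
    case: (eqVneq i i0) => [ei|ni]; first by rewrite e ei; lia.
    by have := geq i ltac:(lia) ij'; rewrite e; have := lpos j jL; lia.
  - move=> p pL; have := psum_move j p li; have := dom p pL.
    case: (ltnP i p) => ip; case: (ltnP j p) => jp /=; try lia.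
    by have := sj p ltac:(lia) jp; lia.
  - by have := psum_move j L li; rewrite jL (ltn_trans ij' jL); lia.
have jp : j = j.-1.+1 by lia.
case: (leqP (lam j + 2) (lam j.-1)) => cj.
  exists j.-1; split; [lia | lia | move=> k kL | ].
    have := ldec k kL; rewrite /move; case: (eqVneq k j.-1) => [->|n1].
      by rewrite -jp eqxx; case: eqP; lia.
    case: (eqVneq k j) => [->|n2]; first by lia.
    by case: (eqVneq k.+1 j) => [e|n3]; [case: n1 | ]; lia.
  by rewrite {2}jp; apply: tab_count_adjacent; rewrite -?jp.
have ji : i0 < j.-1.
  rewrite ltn_neqAle; apply/andP; split; last by lia.
  by apply/eqP => e; rewrite -e in cj; lia.
have lj1 := geq j.-1 ji ltac:(lia).
(* Here lam (j-1) = lam i0 - 1 and lam j = lam i0 - 2. With i the last index of value lam i0, the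
   parts from i to j form a block with c = lam i0 - 1. *)
have exi' : exists i, [&& i0 <= i, i < j & lam i == lam i0].
  by exists i0; rewrite leqnn ij eqxx.
have bnd i : [&& i0 <= i, i < j & lam i == lam i0] -> i <= j by case/and3P=> _ /ltnW.
case: (ex_maxnP exi' bnd) => i /and3P[ii ij' /eqP ei] maxi.
have mid k : i < k -> k < j -> lam k = (lam i0).-1.
  move=> ik kj; have := geq k (leq_ltn_trans ii ik) kj.
  have := lamle i0 k ltac:(lia) ltac:(lia).
  case: (eqVneq (lam k) (lam i0)) => [e|ne]; last by lia.
  by have := maxi k; rewrite e eqxx kj andbT (leq_trans ii (ltnW ik)) => /(_ isT); lia.
have ij1 : i < j.-1.
  rewrite ltn_neqAle; apply/andP; split; last by lia.
  by apply/eqP => e; rewrite -e in cj; lia.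
have cj1 := mid j.-1 ij1 ltac:(lia).
exists i; split=> //.
  move=> k kL; have := ldec k kL; rewrite /move; case: (eqVneq k i) => [->|n1].
    by have := mid i.+1 (leqnn _) ltac:(lia); do 2?[case: eqP]; lia.
  case: (eqVneq k.+1 j) => [e|n2].
    have -> : k = j.-1 by lia.
    by rewrite -jp; do 2?[case: eqP]; lia.
  by case: (eqVneq k j) => [->|n3]; do 2?[case: eqP]; lia.
(* Positivity of the last part c - 1 of the block gives 1 < c. *)
have lpj := lpos j jL.
apply: (@tab_count_block _ _ _ (lam i0).-1) => //; first by lia.
move=> k /andP[ik kj]; case: (eqVneq k j) => [->|n1]; first by case: eqP; lia.
case: (eqVneq k i) => [->|n2]; first by lia.
by have := mid k ltac:(lia) ltac:(lia); lia.
Qed.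

End RibbonTableaux.

Lemma leq_psum2 a b R : (forall k, k < R -> a k <= b k) -> psum a R <= psum b R.
Proof. by move=> h; apply: leq_sum => k _; apply: h. Qed.

Lemma psum_interval p j R :
  psum (fun k => (p <= k) && (k < j) : nat) R = minn R j - p.
Proof. by elim: R => [|R IH]; rewrite ?psum0 ?psumS ?IH; lia. Qed.

Lemma psum_exchange (f : nat -> nat -> nat) p q :
  psum (fun i => psum (f i) q) p = psum (fun j => psum (f^~ j) p) q.
Proof. exact: exchange_big. Qed.

Lemma psum_eqS u x : psum (fun y => u == y.+1 : nat) x = ((0 < u) && (u <= x)).
Proof. by elim: x => [|x IH]; rewrite ?psum0 ?psumS ?IH; lia. Qed.

(** * Tableaux as counting matrices *)

Section SkewTableaux.
Variables (lam mu : seq nat) (n : nat).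
Let R := size lam.
Let b := box_bound lam.
Let l := nth 0 lam.
Let u := nth 0 mu.
Hypotheses (ldec : forall i, l i.+1 <= l i) (udec : forall i, u i.+1 <= u i).
Hypothesis (ul : forall i, u i <= l i).

Let skew i j := (u i <= j) && (j < l i).

Record ssyt_fun (t : mat) : Prop := SsytFun {
  sf_skew : forall i j, skew i j = (0 < t i j);
  sf_max : forall i j, t i j <= n;
  sf_row : forall i j j', skew i j -> skew i j' -> j < j' -> t i j <= t i j';
  sf_col : forall i i' j, skew i j -> skew i' j -> i < i' -> t i j < t i' j }.

Definition row_count (t : mat) : mat := fun i x => psum (fun j => t i j == x.+1 : nat) b.

Definition row_fill (m : mat) : mat := fun i j =>
  if skew i j then (psum (fun x => u i + psum (m i) x.+1 <= j : nat) n).+1 else 0.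

Let lb i : l i <= b.
Proof. by apply: leq_trans (nth_leq_sumn _ _) _; rewrite leq_addl. Qed.

Let lR i : R <= i -> l i = 0.
Proof. exact: nth_default. Qed.

Let skew_b i j : skew i j -> i < b /\ j < b.
Proof.
case/andP=> _ jl; split; last exact: leq_trans (lb i).
case: (ltnP i R) => [iR|/lR e]; last by rewrite e in jl.
by apply: leq_trans iR _; rewrite leq_addr.
Qed.

Let row_countE t i x :
  psum (row_count t i) x = psum (fun j => (0 < t i j) && (t i j <= x) : nat) b.
Proof. by rewrite psum_exchange; apply: eq_psum => j _; apply: psum_eqS. Qed.

(** In a weakly increasing row the entries up to x form an initial segment. *)
Let row_leq t i j x : ssyt_fun t -> skew i j ->
  (t i j <= x) = (j < u i + psum (row_count t i) x).
Proof.
move=> [sk mx rw cl] sij; have /andP[uj jl] := sij; rewrite row_countE.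
have jb := leq_trans jl (lb i); case: (leqP (t i j) x) => h; symmetry.
  suff : j.+1 - u i <= psum (fun j => (0 < t i j) && (t i j <= x) : nat) b by lia.
  rewrite -{1}(minn_idPr jb) -psum_interval; apply: leq_psum2 => k _.
  case: (boolP ((u i <= k) && (k < j.+1))) => // /andP[uk kj].
  have sik : skew i k by rewrite /skew uk (leq_ltn_trans _ jl).
  rewrite -sk sik /= lt0b; apply: (leq_trans _ h).
  by move: kj; rewrite ltnS leq_eqVlt => /orP[/eqP->//|]; apply: rw.
suff : psum (fun j => (0 < t i j) && (t i j <= x) : nat) b <= j - u i by lia.
rewrite -{1}(minn_idPr (ltnW jb)) -psum_interval; apply: leq_psum2 => k _.
case: (boolP (0 < t i k)) => //=; rewrite -sk => sik; have /andP[uk kl] := sik.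
case: (leqP (t i k) x) => // tk; rewrite uk /= lt0b ltnNge; apply/negP => jk.
have : t i j <= t i k; last by lia.
by move: jk; rewrite leq_eqVlt => /orP[/eqP->//|]; apply: rw.
Qed.

Lemma row_count_ssyt t : ssyt_fun t ->
  ssyt_mat R n u (fun i => l i - u i) (row_count t).
Proof.
move=> st; have [sk mx rw cl] := st.
have tot i x : n <= x -> psum (row_count t i) x = l i - u i.
  move=> nx; rewrite row_countE -{1}(minn_idPr (lb i)) -psum_interval.
  by apply: eq_psum => j _; rewrite -sk -/(skew i j) (leq_trans (mx i j) nx) andbT.
split.
- move=> i x Ri; apply: psum_eq0 => j _; case: eqP => // e.
  by have := sk i j; rewrite e /skew (lR Ri) andbF.
- by move=> i x nx; apply: psum_eq0 => j _; have := mx i j; case: eqP => // ->; lia.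
- by move=> i _; apply: tot.
move=> i x; rewrite leqNgt; apply/negP => h.
set k := u i + _ in h.
have ki : u i <= k by rewrite leq_addr.
have kl : k < l i.+1.
  apply: leq_trans h _; rewrite -(subnKC (ul i.+1)) leq_add2l.
  rewrite -(tot i.+1 (maxn n x.+1)) ?leq_maxl //; apply: leq_psum; exact: leq_maxr.
have s1 : skew i.+1 k by rewrite /skew kl (leq_trans (udec i)).
have s0 : skew i k by rewrite /skew ki (leq_trans kl).
have h1 : t i.+1 k <= x.+1 by rewrite (row_leq x.+1 st s1).
have := row_leq x st s0; rewrite -/k ltnn; have := cl _ _ _ s0 s1 (ltnSn i); lia.
Qed.

Lemma row_count_inj t t' : ssyt_fun t -> ssyt_fun t' -> row_count t = row_count t' -> t = t'.
Proof.
move=> st st' e; apply/funext => i; apply/funext => j.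
case: (boolP (skew i j)) => sij; last first.
  by move: (sij); rewrite (sf_skew st) lt0n negbK => /eqP->; move: sij;
     rewrite (sf_skew st') lt0n negbK => /eqP->.
apply/anti_leq/andP; split.
  by rewrite (row_leq _ st) // e -(row_leq _ st').
by rewrite (row_leq _ st') // -e -(row_leq _ st).
Qed.

Section Fill.
Variable m : mat.
Hypothesis sm : ssyt_mat R n u (fun i => l i - u i) m.
Let c i x := u i + psum (m i) x.

Let c_n i : c i n = l i.
Proof.
rewrite /c; case: (ltnP i R) => iR; first by rewrite (sm_row sm) // subnKC.
rewrite psum_eq0 ?addn0; last by move=> k _; apply: (sm_supp sm).
by have := ul i; rewrite (lR iR); lia.
Qed.

Let c_le i x y : x <= y -> c i x <= c i y.
Proof. by move=> xy; rewrite leq_add2l leq_psum. Qed.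

Let fill_leq i j x : skew i j -> x <= n -> (row_fill m i j <= x) = (j < c i x).
Proof.
move=> sij xn; rewrite /row_fill sij; have /andP[uj jl] := sij.
have ex z : z <= n -> z = psum (fun y => (0 <= y) && (y < z) : nat) n.
  by move=> zn; rewrite psum_interval (minn_idPr zn) subn0.
case: x xn => [|x] xn; first by rewrite /c psum0; lia.
rewrite ltnS; case: (ltnP j (c i x.+1)) => h.
  rewrite [X in _ <= X](ex x (ltnW xn)).
  apply: leq_psum2 => y _; case: (leqP (u i + psum (m i) y.+1) j) => //= hy.
  rewrite lt0b ltnNge; apply/negP => xy.
  by have := @c_le i x.+1 y.+1 xy; rewrite /c in h *; lia.
apply/negbTE; rewrite -ltnNge [X in X <= _](ex x.+1 xn).
apply: leq_psum2 => y _; case: (ltnP y x.+1) => //= hy; rewrite lt0b.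
by apply: leq_trans (c_le i hy) h.
Qed.

Lemma row_fill_ssyt : ssyt_fun (row_fill m).
Proof.
have mx i j : row_fill m i j <= n.
  case: (boolP (skew i j)) => sij; last by rewrite /row_fill (negbTE sij).
  by rewrite fill_leq // c_n; case/andP: sij.
split=> // [i j|i j j' s s' jj|i i' j s].
- by rewrite /row_fill; case: ifP.
- rewrite fill_leq //; apply: ltn_trans jj _.
  by rewrite -fill_leq.
elim: i' => // i' IH s'; rewrite ltnS leq_eqVlt => ii.
have step : skew i' j -> row_fill m i' j < row_fill m i'.+1 j.
  move=> s0; have : 0 < row_fill m i'.+1 j by rewrite /row_fill s'.
  case e : (row_fill m i'.+1 j) => [//|x] _; rewrite ltnS fill_leq //; last first.
    by have := mx i'.+1 j; rewrite e; lia.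
  apply: leq_trans (sm_gt sm i' x); rewrite -/(c _ _) -fill_leq ?e //.
  by rewrite -e.
case/orP: ii => [/eqP e|ii]; first by rewrite e in s *; apply: step.
have s0 : skew i' j.
  have le : u i' <= u i.
    move: ii {IH s s' step}; elim: i' => // k IHk; rewrite ltnS leq_eqVlt.
    by case/orP=> [/eqP->//|/IHk]; apply: leq_trans.
  case/andP: s => h1 _; case/andP: s' => _ h2; apply/andP; split.
    exact: leq_trans h1.
  exact: leq_trans (ldec i').
exact: ltn_trans (IH s0 ii) (step s0).
Qed.

Lemma row_fillK : row_count (row_fill m) = m.
Proof.
have [sk mx _ _] := row_fill_ssyt.
have tot i x : x <= n -> psum (row_count (row_fill m) i) x = psum (m i) x.
  move=> xn; rewrite row_countE -[RHS](addKn (u i)) -/(c i x).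
  have cb : c i x <= b by apply: leq_trans (lb i); rewrite -c_n c_le.
  rewrite -{1}(minn_idPr cb) -psum_interval; apply: eq_psum => j _; rewrite -sk.
  case: (boolP (skew i j)) => sij /=.
    by rewrite fill_leq //; case/andP: sij => ->.
  case: (boolP (_ && _)) => // /andP[h1 h2]; case/negP: sij; rewrite /skew h1 /=.
  by apply: leq_trans h2 _; rewrite -c_n c_le.
apply/funext => i; apply/funext => x; case: (ltnP x n) => xn.
  by have := tot i x.+1 xn; rewrite !psumS tot ?(ltnW xn) // => /addnI.
rewrite (sm_col sm) //; apply: psum_eq0 => j _.
by have := mx i j; case: eqP => // ->; lia.
Qed.

End Fill.

Lemma ssyt_fun_boxed t : ssyt_fun t -> boxed b b n t.
Proof.
case=> sk mx _ _; split=> // i j h; apply/eqP; rewrite -leqn0 leqNgt -sk;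
  by apply/negP => /skew_b[]; lia.
Qed.

Lemma skew_coefE (a : {ffun 'I_n -> nat}) (B : nat) : sumn lam <= B ->
  skew_coef lam mu n a =
  mcount R n B (fun m => ssyt_mat R n u (fun i => l i - u i) m /\ has_wt R m a).
Proof.
move=> lB.
have -> : skew_coef lam mu n a = mcount b b n (fun t => ssyt_fun t /\ has_wt R (row_count t) a).
  apply: eq_card => d; rewrite !inE.
  have dE (i j : 'I_b) : decode d i j = d (i, j) by rewrite decodeE.
  have [d0 d1 dn] := decode_boxed d.
  have ct (k : 'I_n) : content lam n d k = colsum b (row_count (decode d)) k.
    rewrite /content -sum1_card big_mkcond /colsum /psum /row_count /psum.
    rewrite pair_bigA /=; apply: eq_bigr => -[i j] _; rewrite inE /=.
    by rewrite /col /= -dE; case: eqP.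
  have cR (k : 'I_n) : (forall i j, skew i j = (0 < decode d i j)) ->
      colsum b (row_count (decode d)) k = colsum R (row_count (decode d)) k.
    move=> sk; apply: psum_stable; last by rewrite /b /box_bound leq_addr.
    move=> i Ri; apply: psum_eq0 => j _; case: eqP => // e.
    by have := sk i j; rewrite e /skew (lR Ri) andbF.
  apply/andP/asboolP.
    move=> [/andP[/andP[/forallP h1 /forallP h2] /forallP h3] /forallP h4].
    have sk i j : skew i j = (0 < decode d i j).
      case: (ltnP i b) => ib; last first.
        by rewrite d0 //; apply/negbTE/negP => /skew_b[]; lia.
      case: (ltnP j b) => jb; last first.
        by rewrite d1 //; apply/negbTE/negP => /skew_b[]; lia.
      by have /= := h1 (Ordinal ib, Ordinal jb); rewrite -dE lt0n => /eqP <-.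
    split; last by move=> k; rewrite -cR // -ct; apply/eqP.
    split=> // [i j j' s s' jj|i i' j s s' ii].
      have [ib jb] := skew_b s; have [_ jb'] := skew_b s'.
      have := h2 (Ordinal ib); move/forallP/(_ (Ordinal jb)); move/forallP/(_ (Ordinal jb')).
      rewrite /= -!dE; move/implyP; apply.
      by rewrite /in_skew -/(skew i j) -/(skew i j') s s'.
    have [ib jb] := skew_b s; have [ib' _] := skew_b s'.
    have := h3 (Ordinal ib); move/forallP/(_ (Ordinal ib')); move/forallP/(_ (Ordinal jb)).
    rewrite /= -!dE; move/implyP; apply.
    by rewrite /in_skew -/(skew i j) -/(skew i' j) s s'.
  move=> [[sk mx rw cl] hw]; split; last first.
    by apply/forallP => k; rewrite ct cR // hw.
  apply/andP; split; first (apply/andP; split).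
  - by apply/forallP => -[i j] /=; rewrite -dE -lt0n -sk.
  - apply/forallP => i; apply/forallP => j; apply/forallP => j'; apply/implyP.
    by case/and3P=> s s' jj; rewrite /= -!dE; apply: rw.
  - apply/forallP => i; apply/forallP => i'; apply/forallP => j; apply/implyP.
    by case/and3P=> s s' ii; rewrite /= -!dE; apply: cl.
have rsB i : l i - u i <= B.
  by apply: leq_trans (leq_subr _ _) (leq_trans (nth_leq_sumn _ _) lB).
apply/anti_leq/andP; split.
  apply: (mcount_le (F := row_count)) => [t _ [h hw]|t t' _ [h _] _ [h' _]].
    have sm := row_count_ssyt h; split=> //; exact: ssyt_mat_boxed rsB sm.
  exact: row_count_inj.
apply: (mcount_le (F := row_fill)) => [m _ [h hw]|m m' _ [h _] _ [h' _] e].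
  have sf := row_fill_ssyt h; split; first exact: ssyt_fun_boxed.
  by split=> //; rewrite row_fillK.
by rewrite -(row_fillK h) e row_fillK.
Qed.

End SkewTableaux.

Lemma psum_take (s : seq nat) p : psum (nth 0 s) p = sumn (take p s).
Proof.
rewrite -(psum_nth (R := p)); last by rewrite size_take_min geq_minl.
by apply: eq_psum => k kp; rewrite nth_take.
Qed.

(** * Ribbons *)

Section Ribbon.
Variable al : seq nat.
Hypothesis alpos : is_composition al.
Let L := size al.
Let rl := nth 0 (ribbon_lam al).
Let rm := nth 0 (ribbon_mu al).

Lemma composition_pos k : k < L -> 0 < nth 0 al k.
Proof. by move=> kL; apply: (allP alpos); apply: mem_nth. Qed.

Let sumn_drop k : L - k <= sumn (drop k al).
Proof.
rewrite -size_drop; have : all (fun x => 0 < x) (drop k al).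
  by apply/allP => x /mem_drop; apply/allP.
by elim: (drop k al) => //= x s IH /andP[x0 /IH]; lia.
Qed.

Let drop_cons k : k < L -> sumn (drop k al) = nth 0 al k + sumn (drop k.+1 al).
Proof. by move=> kL; rewrite (drop_nth 0). Qed.

Let rlE k : k < L -> rl k = sumn (drop k al) - (L - k.+1).
Proof. by move=> kL; rewrite /rl /ribbon_lam nth_mkseq. Qed.

Let rmE k : k < L -> rm k = sumn (drop k.+1 al) - (L - k.+1).
Proof.
move=> kL; rewrite /rm /ribbon_mu nth_mkseq // -/rl.
case: (ltnP k.+1 L) => k1.
  by rewrite rlE //; have := sumn_drop k.+1; lia.
by rewrite /rl nth_default ?size_mkseq // drop_oversize.
Qed.

Lemma ribbon_lam_mu k : rl k = rm k + nth 0 al k.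
Proof.
case: (ltnP k L) => kL; last by rewrite /rl /rm !nth_default ?size_mkseq.
by rewrite rlE // rmE // drop_cons //; have := sumn_drop k.+1; lia.
Qed.

Lemma ribbon_mu_lam k : k.+1 < L -> rl k.+1 = (rm k).+1.
Proof. by move=> kL; rewrite rlE // rmE ?(ltnW kL) //; have := sumn_drop k.+1; lia. Qed.

Lemma ribbon_mu_dec k : rm k.+1 <= rm k.
Proof.
case: (ltnP k.+1 L) => kL; last by rewrite {1}/rm nth_default ?size_mkseq.
by have := ribbon_mu_lam kL; have := ribbon_lam_mu k.+1; have := composition_pos kL; lia.
Qed.

Lemma ribbon_lam_dec k : rl k.+1 <= rl k.
Proof.
case: (ltnP k.+1 L) => kL; last by rewrite {1}/rl nth_default ?size_mkseq.
by rewrite (ribbon_mu_lam kL) ribbon_lam_mu; have := composition_pos (ltnW kL); lia.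
Qed.

Variable n : nat.

(** Rows k and k+1 share one column, holding the first entry of row k above the last entry of row
    k+1. The former is smaller than the latter exactly when some letter of row k is smaller than
    some letter of row k+1. *)
Lemma ribbon_ssyt_mat m : ssyt_mat L n rm (nth 0 al) m <->
  [/\ rowsupp L m, (forall r x, n <= x -> m r x = 0),
      (forall r, r < L -> psum (m r) n = nth 0 al r) &
      forall k, k.+1 < L -> pair (fun x k => m k x) k].
Proof.
split=> [[mR mn mr mg]|[mR mn mr mp]]; split=> //.
  move=> k kL; have exy : exists y, 0 < m k y.
    apply: contrapT => no; have := composition_pos (ltnW kL); rewrite -mr ?(ltnW kL) //.
    rewrite psum_eq0 // => y _; case: (posnP (m k y)) => // my; by case: no; exists y.
  case: (ex_minnP exy) => y my miny.
  have z0 : psum (m k) y = 0.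
    apply: psum_eq0 => j jy; case: (posnP (m k j)) => // mj.
    by have := miny _ mj; lia.
  have lt : psum (m k.+1) y.+1 < psum (m k.+1) n.
    have := mg k y; rewrite z0 mr //; have := ribbon_mu_lam kL.
    by rewrite ribbon_lam_mu; lia.
  by have [z [yz _ mz]] := psum_ex lt; exists y, z.
move=> k x; case: (ltnP k.+1 L) => kL; last first.
  rewrite {1}/rm nth_default ?size_mkseq // psum_eq0 // => j _; exact: mR.
have [y [z [yz my mz]]] := mp k kL; have := ribbon_mu_lam kL; rewrite ribbon_lam_mu.
have zn : z < n by case: ltnP => // /(mn k.+1) e; rewrite e in mz.
have mrk := mr _ kL.
have lei : psum (m k.+1) x.+1 <= nth 0 al k.+1.
  case: (leqP x.+1 n) => xn; first by rewrite -mrk leq_psum.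
  by rewrite -mrk (psum_stable (R := n)) // => [j|]; [apply: mn | apply: ltnW].
case: (leqP x.+1 z) => xz.
  by have := psum_gt (m k.+1) xz zn; rewrite mrk; lia.
have yx : y < x by lia.
by have := psum_gt (m k) (leq0n y) yx; rewrite psum0; lia.
Qed.

Let B := sumn (ribbon_lam al).

Lemma ribbon_bound r : nth 0 al r <= B.
Proof. by apply: leq_trans (nth_leq_sumn _ r); rewrite -/rl ribbon_lam_mu leq_addl. Qed.

Lemma ribbon_coefE (a : {ffun 'I_n -> nat}) :
  ((ribbon_coef al n a)%:R = skew_chr L B rm (nth 0 al) a :> rat)%R.
Proof.
rewrite /ribbon_coef /skew_chr (@skew_coefE _ _ _ _ _ _ _ B) //.
- rewrite size_mkseq; congr (_%:R)%R; apply: eq_card => d; rewrite !inE.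
  have -> // : (fun i => nth 0 (ribbon_lam al) i - nth 0 (ribbon_mu al) i) = nth 0 al.
  by apply/funext => i; rewrite -/rl -/rm ribbon_lam_mu addKn.
- exact: ribbon_lam_dec.
- exact: ribbon_mu_dec.
- by move=> i; rewrite -/rl -/rm ribbon_lam_mu leq_addr.
Qed.

Definition nat_wt (kappa : {ffun 'I_n -> nat}) (x : nat) : nat :=
  if insub x is Some k then kappa k else 0.

(** Transposing the matrix turns the lattice inequalities literally into [gt_pattern] with zero
    offset, and column strictness of the ribbon into [rt_pair]. *)
Lemma hw_tab_count kappa B' : (forall x, nat_wt kappa x <= B') ->
  hw_count L B rm (nth 0 al) kappa = tab_count L n B' (nat_wt kappa) (nth 0 al).
Proof.
move=> kB; have wE (k : 'I_n) : nat_wt kappa k = kappa k by rewrite /nat_wt valK.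
have trK (m m' : mat) : (fun x k => m k x) = (fun x k => m' k x) -> m = m'.
  by move=> e; apply/funext => x; apply/funext => k; move/funeqP/(_ k)/funeqP/(_ x): e.
apply/anti_leq/andP; split.
  apply: (mcount_le (F := fun m x k => m k x)) => [m _ [sm lat hw]|m m' _ _ _ _]; last exact: trK.
  suff h : ribbon_tab L n (nat_wt kappa) (nth 0 al) (fun x k => m k x).
    by split=> //; apply: ribbon_tab_boxed h.
  have [mR mn mr mp] := (ribbon_ssyt_mat m).1 sm; split=> //.
  - by move=> x k xn; apply: mn.
  - by move=> x k Lk; apply: mR.
  - by move=> x xn; have /= -> := wE (Ordinal xn); rewrite -hw.
  - move=> x k; rewrite !add0n -/(col m x.+1) -/(col m x).
    case: (ltnP x.+1 n) => xn; last by rewrite psum_eq0 // => j _; apply: mn.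
    case: (ltnP k L) => kL; first by have := lat k x kL xn; rewrite /height; lia.
    (* For k >= L the partial sums are constant, and the inequality follows from the lattice
       condition in the last row L-1. *)
    case: (posnP L) => L0; first by rewrite psum_eq0 // => j _; apply: mR; rewrite L0.
    have := lat L.-1 x ltac:(lia) xn; rewrite /height (prednK L0).
    have st y q : L <= q -> psum (col m y) q = psum (col m y) L.
      by move=> Lq; apply: psum_stable => // j; apply: mR.
    rewrite (st x.+1 k.+1) ?(leqW kL) // (st x k kL).
    by have := leq_psum (col m x) (leq_pred L); lia.
apply: (mcount_le (F := fun m x k => m k x)) => [q _ hq|m m' _ _ _ _]; last exact: trK.
case: hq => qR qc qr qg qa qp.
have sm : ssyt_mat L n rm (nth 0 al) (fun k x => q x k).
  by apply/ribbon_ssyt_mat; split=> // [r x|r x]; [apply: qc | apply: qR].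
split; first exact: ssyt_mat_boxed ribbon_bound sm.
split=> //.
- by move=> k x kL xn; rewrite /height Num.Theory.subr_le0 lez_nat; apply: qg.
- by move=> k; rewrite -wE -qr.
Qed.

End Ribbon.

Lemma schur_coefE n nu (a : {ffun 'I_n -> nat}) : is_partition nu ->
  ((schur_coef nu n a)%:R = straight_chr nu a :> rat)%R.
Proof.
move=> nuP; rewrite /schur_coef /straight_chr /skew_chr (@skew_coefE _ _ _ _ _ _ _ (sumn nu)) //.
- congr (_%:R)%R; apply: eq_card => d; rewrite !inE.
  have -> : nth 0 [::] = (fun _ => 0) by apply/funext => i; rewrite nth_nil.
  by have -> // : (fun i => nth 0 nu i - 0) = nth 0 nu by apply/funext => i; rewrite subn0.
- by move=> i; apply: nth_partition.
- by move=> i; rewrite !nth_nil.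
Qed.

Lemma partition_composition lam : is_partition lam -> is_composition lam.
Proof. by case/andP. Qed.

(** * The two directions of the equivalence for ribbons *)

Definition rib_hw (al : seq nat) n (kappa : {ffun 'I_n -> nat}) : nat :=
  hw_count (size al) (sumn (ribbon_lam al)) (nth 0 (ribbon_mu al)) (nth 0 al) kappa.

Lemma rib_hw_dom n lam mu : is_partition lam -> is_partition mu ->
  sumn lam = sumn mu -> dom_le mu lam -> size lam = size mu ->
  forall kappa : {ffun 'I_n -> nat}, rib_hw lam kappa <= rib_hw mu kappa.
Proof.
move=> lP mP eN dom eL kappa; have lc := partition_composition lP.
have kB x : nat_wt kappa x <= weight_sum kappa.
  rewrite /nat_wt; case: insubP => // k _ _.
  by rewrite /weight_sum (bigD1 k) //= leq_addr.
rewrite /rib_hw (hw_tab_count lc kB) (hw_tab_count (partition_composition mP) kB) eL.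
apply: tab_count_dom => //.
- by move=> k _; apply: nth_partition.
- by move=> k _; apply: nth_partition.
- by move=> k; rewrite -eL; apply: composition_pos.
- by move=> p _; rewrite !psum_take.
- by rewrite !psum_nth ?eL.
Qed.

Lemma rib_hw_of_schur_pos lam mu n : is_partition lam -> is_partition mu ->
  schur_pos_n n (fun a => ((ribbon_coef mu n a)%:R - (ribbon_coef lam n a)%:R)%R) ->
  forall kappa : {ffun 'I_n -> nat}, dominant kappa -> rib_hw lam kappa <= rib_hw mu kappa.
Proof.
move=> lP mP [s [c [sP [c0 e]]]].
have lc := partition_composition lP; have mc := partition_composition mP.
apply: (hw_le_of_schur_pos (ribbon_bound mc) (ribbon_bound lc) c0 (s := s)).
move=> a; rewrite -!ribbon_coefE ?partition_composition // e big_seq [RHS]big_seq.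
by apply: eq_bigr => nu nus; rewrite schur_coefE //; apply: (allP sP).
Qed.

Lemma schur_pos_of_rib_hw N lam mu n : is_partition lam -> is_partition mu ->
  sumn lam = N -> sumn mu = N ->
  (forall kappa : {ffun 'I_n -> nat}, rib_hw lam kappa <= rib_hw mu kappa) ->
  schur_pos_n n (fun a => ((ribbon_coef mu n a)%:R - (ribbon_coef lam n a)%:R)%R).
Proof.
move=> lP mP lN mN le; have lc := partition_composition lP; have mc := partition_composition mP.
have [s [c [sP c0 e]]] := schur_pos_of_hw_le (ribbon_bound mc) (ribbon_bound lc)
  (etrans (psum_nth (leqnn _)) mN) (etrans (psum_nth (leqnn _)) lN) le.
exists s, c; split=> //; split=> // a.
have -> : a = [ffun k => a k] by apply/funext => k; rewrite ffunE.
rewrite !ribbon_coefE // e big_seq [RHS]big_seq.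
by apply: eq_bigr => nu nus; rewrite schur_coefE //; apply: (allP sP).
Qed.

Lemma rib_hw_gt0 al n kappa m : is_composition al ->
  rowsupp (size al) m -> (forall r x, n <= x -> m r x = 0) ->
  (forall r, r < size al -> psum (m r) n = nth 0 al r) ->
  (forall k, k.+1 < size al -> pair (fun x k => m k x) k) ->
  lattice (size al) n m -> has_wt (size al) m kappa -> 0 < @rib_hw al n kappa.
Proof.
move=> alP mR mn mr mp lat hw.
have sm : ssyt_mat (size al) n (nth 0 (ribbon_mu al)) (nth 0 al) m by apply/ribbon_ssyt_mat.
rewrite card_gt0; apply/set0Pn; exists (encode (size al) n (sumn (ribbon_lam al)) m).
rewrite inE; apply/asboolP; rewrite encodeK //.
exact: ssyt_mat_boxed (ribbon_bound alP) sm.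
Qed.

Lemma rib_hw_exists al n kappa : is_composition al -> 0 < @rib_hw al n kappa ->
  exists m, [/\ ssyt_mat (size al) n (nth 0 (ribbon_mu al)) (nth 0 al) m,
    lattice (size al) n m & has_wt (size al) m kappa].
Proof. by move=> alP; rewrite lt0n => /mcount_exists. Qed.

Lemma psum_supp a R p : (forall k, R <= k -> a k = 0) -> psum a p <= psum a R.
Proof.
move=> a0; case: (leqP p R) => [/leq_psum//|/ltnW Rp].
by rewrite (psum_stable a0 Rp).
Qed.

(** By [lattice_up] the first p rows of a lattice filling of the ribbon mu hold only letters below
    p, and weight lam provides lam_1 + .. + lam_p of these. *)
Lemma rib_hw_dominance lam mu : is_partition lam -> is_partition mu ->
  rib_hw lam (pad (size lam) lam) <= rib_hw mu (pad (size lam) lam) -> dom_le mu lam.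
Proof.
move=> lP mP; have lc := partition_composition lP.
have [dR dn dr _] := diag_ssyt_mat lP (leqnn _).
have pos : 0 < rib_hw lam (pad (size lam) lam).
  apply: (rib_hw_gt0 lc dR dn dr _ (diag_lattice lP (leqnn _))) => k.
    move=> kL; exists k, k.+1; rewrite /diag_mat !eqxx ltnSn.
    by split; rewrite // composition_pos // ltnW.
  by rewrite /colsum diag_mat_col ffunE ltn_ord.
move/(leq_trans pos)/(rib_hw_exists (partition_composition mP)) => [m [sm lat hw]] p.
have [mR mn mr _] := sm; have up := lattice_up mR mn lat.
rewrite -!psum_take.
have row i : i < p -> nth 0 mu i <= psum (m i) p.
  move=> ip; case: (ltnP i (size mu)) => iR; last by rewrite nth_default.
  by rewrite -mr //; apply: psum_supp => x px; apply: up; apply: leq_trans px.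
apply: leq_trans (leq_psum2 row) _; rewrite psum_exchange; apply: leq_psum2 => x _.
apply: (leq_trans (psum_supp (R := size mu) _ _)); first by move=> k; apply: mR.
case: (ltnP x (size lam)) => xn; last by rewrite psum_eq0 // => k _; apply: mn.
by have := hw (Ordinal xn); rewrite ffunE /colsum => <-.
Qed.

Lemma dom_le_size lam mu : is_composition lam -> sumn lam = sumn mu ->
  dom_le mu lam -> size lam <= size mu.
Proof.
move=> lc eN dom; rewrite leqNgt; apply/negP => lt.
have := dom (size mu); rewrite take_size -eN -psum_take -(psum_nth (leqnn (size lam))).
by have := psum_gt (nth 0 lam) (leqnn _) lt; have := composition_pos lc lt; lia.
Qed.

(* Its weight is the hook (N - L + 1, 1^(L-1)), for L = size al and N = sumn al. *)
Definition hook_mat (al : seq nat) : mat := fun k x =>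
  if k < size al then (x == 0) * (nth 0 al k).-1 + (x == k) else 0.

Section Hook.
Variable al : seq nat.
Hypothesis alpos : is_composition al.
Let L := size al.

Lemma hook_mat_psum k x : k < L ->
  psum (hook_mat al k) x = (0 < x) * (nth 0 al k).-1 + (k < x).
Proof.
move=> kL; elim: x => [|x IH]; rewrite ?psum0 // psumS IH /hook_mat kL.
by case: (x) => [|y]; rewrite ?ltnn !ltn0Sn ?eqxx ?eqSS /= ?mul0n ?mul1n; lia.
Qed.

Lemma hook_mat_col x k : psum (col (hook_mat al) x.+1) k = (x.+1 < minn k L).
Proof.
elim: k => [|k IH]; first by rewrite psum0 min0n.
rewrite psumS IH colE /hook_mat /= mul0n; case: ifP; lia.
Qed.

Lemma hook_mat_col0 : psum (col (hook_mat al) 0) L + L = sumn al + (0 < L).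
Proof.
rewrite -(psum_nth (leqnn _)) -/L.
suff h k : k <= L -> psum (col (hook_mat al) 0) k + k = psum (nth 0 al) k + (0 < k).
  exact: h.
elim: k => [|k IH] kL; first by rewrite !psum0.
have := IH (ltnW kL); have := composition_pos alpos kL.
by rewrite !psumS colE /hook_mat kL; case: (k) => [|y]; lia.
Qed.

Lemma hook_ssyt_mat : ssyt_mat L L (nth 0 (ribbon_mu al)) (nth 0 al) (hook_mat al).
Proof.
apply/ribbon_ssyt_mat => //; split.
- by move=> r x Lr; rewrite /hook_mat ltnNge Lr.
- by move=> r x Lx; rewrite /hook_mat; case: ltnP => // rL; have [-> ->] : x == 0 = false /\ x == r = false by lia.
- move=> r rL; rewrite hook_mat_psum // rL (leq_ltn_trans _ rL) // mul1n.
  by have := composition_pos alpos rL; lia.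
- by move=> k kL; exists k, k.+1; rewrite /hook_mat kL (ltnW kL) !eqxx !addn1 ltnSn; split.
Qed.

Lemma hook_lattice : lattice L L (hook_mat al).
Proof.
move=> i [|t] iL tL; rewrite /height hook_mat_col; last by rewrite hook_mat_col; lia.
case: i iL => [|i] iL; first by rewrite psum0; lia.
have := psum_gt (col (hook_mat al) 0) (leqnn 0) (ltn0Sn i).
rewrite colE /hook_mat (leq_ltn_trans _ iL) // psum0; lia.
Qed.

End Hook.

(** The hook weight of [hook_mat lam] has N - l(lam) + 1 letters 0. Every row of the ribbon mu but
    the first contains a nonzero letter, the larger one of its pair with the row above, which leaves
    room for at most N - l(mu) + 1 letters 0. *)
Lemma rib_hw_length lam mu : is_partition lam -> is_partition mu ->
  sumn lam = sumn mu ->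
  (forall kappa : {ffun 'I_(size lam) -> nat}, dominant kappa ->
     rib_hw lam kappa <= rib_hw mu kappa) -> size mu <= size lam.
Proof.
move=> lP mP eN le; have lc := partition_composition lP; have mc := partition_composition mP.
have [L0|L0] := posnP (size lam).
  move: eN; rewrite (size0nil L0) /= => eN; rewrite leqNgt; apply/negP => mu0.
  by have := nth_leq_sumn mu 0; rewrite -eN; have := composition_pos mc mu0; lia.
pose kappa : {ffun 'I_(size lam) -> nat} := [ffun x : 'I_(size lam) => colsum (size lam) (hook_mat lam) x].
have hw : has_wt (size lam) (hook_mat lam) kappa by move=> k; rewrite ffunE.
have sm := hook_ssyt_mat lc; have lat := hook_lattice lc.
have dk : dominant kappa := lattice_dominant sm lat hw.
have pos : 0 < rib_hw lam kappa.
  by have [a1 a2 a3 a4] := (ribbon_ssyt_mat lc _ _).1 sm; apply: rib_hw_gt0 lat hw.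
have [m [sm' _ hw']] := rib_hw_exists mc (leq_trans pos (le _ dk)).
have [_ _ mr mp] := (ribbon_ssyt_mat mc _ _).1 sm'.
have k0 : psum (col m 0) (size mu) + size lam = sumn mu + 1.
  have := hw' (Ordinal L0); rewrite ffunE /colsum /= => ->.
  by rewrite hook_mat_col0 // L0 eN.
(* At least k letters of the first k+1 rows are nonzero. *)
suff h k : k < size mu -> psum (col m 0) k.+1 + k <= psum (nth 0 mu) k.+1.
  case: (posnP (size mu)) => [->//|mu0].
  by have := h (size mu).-1; rewrite (prednK mu0) psum_nth //; lia.
elim: k => [|k IH] kM.
  rewrite !psumS !psum0 colE -(mr 0 kM).
  by have := psum_gt (m 0) (leq0n 0) L0; rewrite psum0; lia.
have [y [z [yz _ mz]]] := mp k kM; have := IH (ltnW kM).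
rewrite (psumS _ k.+1) (psumS _ k.+1) colE -(mr _ kM).
have zn : z < size lam.
  by case: ltnP => // /(sm_col sm' k.+1) e; rewrite e in mz.
have := psum_gt (m k.+1) (leq0n 0) (leq_ltn_trans (leq0n y) yz); rewrite psum0.
by have := psum_gt (m k.+1) (leqnn z) zn; lia.
Qed.

Theorem theorem3p3 (N : nat) (lam mu : seq nat) :
  is_partition lam -> sumn lam = N ->
  is_partition mu -> sumn mu = N ->
  (schur_positive (fun n a => ((ribbon_coef mu n a)%:R - (ribbon_coef lam n a)%:R)%R)
   <-> (dom_le mu lam /\ size lam = size mu)).
Proof.
move=> lP lN mP mN; split=> [sp|[dom eL] n].
  have le n := rib_hw_of_schur_pos lP mP (sp n).
  (* Both parts of the necessity are read off in [size lam] variables. *)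
  have dom : dom_le mu lam by apply: rib_hw_dominance => //; apply/le/pad_dominant.
  split=> //; apply/anti_leq; rewrite (rib_hw_length lP mP) ?lN // ?mN //; last exact: le.
  by rewrite dom_le_size ?lN ?mN // partition_composition.
apply: (schur_pos_of_rib_hw (N := N)) => // kappa.
by apply: rib_hw_dom; rewrite ?lN ?mN.
Qed.
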